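(* Consider a multimessage multicast network consisting of independent discrete memoryless channels (one DMC $q_{Y_{(i,j)}|X_{(i,j)}}$ with finite alphabets for each directed edge $(i,j)\in\mathcal{E}=\mathcal{I}\times\mathcal{I}$, $\mathcal{I}=\{1,\ldots,N\}$), possibly with zero-delay edges, under multicast demand $(\mathcal{V},\mathcal{D})$. Let $$C_{(i,j)}\triangleq\max_{p_{X_{(i,j)}}}I_{p_{X_{(i,j)}}q_{Y_{(i,j)}|X_{(i,j)}}}(X_{(i,j)};Y_{(i,j)})$$ be the capacity of the channel on edge $(i,j)$. Then $$\mathcal{C}=\mathcal{C}^{\mathbf{1}}=\bigcap_{T\subseteq\mathcal{I}:\,T^c\cap\mathcal{D}\neq\emptyset}\left\{R_\mathcal{I}\in\mathbb{R}_+^N\ \Big|\ \sum_{i\in T}R_i\le\sum_{(i,j)\in T\times T^c}C_{(i,j)}\right\},$$ where $\mathcal{C}$ is the capacity region, $\mathcal{C}^{\mathbf{1}}$ is the $\mathbf{1}$-capacity region (the capacity region under the all-one delay profile), and all rate tuples $R_\mathcal{I}$ (in all three sets) are understood to satisfy $R_i=0$ for every $i\notin\mathcal{V}$.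
   Context: Notation. $\mathcal{I}=\{1,\ldots,N\}$ (nodes), $\mathcal{E}=\mathcal{I}\times\mathcal{I}$ (directed edges); $T^c=\mathcal{I}\setminus T$; $\mathbb{R}_+$ is the set of non-negative reals; logarithms are to base 2. For $A\subseteq\mathcal{E}$, $X_A=(X_e:e\in A)$, $X_{A,k}=(X_{e,k}:e\in A)$ for time $k$; a superscript as in $X_A^{k}$ denotes $(X_{A,1},\ldots,X_{A,k})$ (empty if $k=0$); similarly for $Y$. Demand. $\mathcal{V}\subseteq\mathcal{I}$ is the set of sources, $\mathcal{D}\subseteq\mathcal{I}$ the set of destinations; each destination wants the messages of all sources. Network. For each $(i,j)\in\mathcal{E}$ there are finite alphabets $\mathcal{X}_{(i,j)},\mathcal{Y}_{(i,j)}$ and a channel (conditional distribution) $q_{Y_{(i,j)}|X_{(i,j)}}$. Set $\Omega_{N(i-1)+j}=\{(i,j)\}$, so $(\Omega_1,\ldots,\Omega_{N^2})$ is a partition of $\mathcal{E}$ into singletons, and let $q^{(N(i-1)+j)}=q_{Y_{(i,j)}|X_{(i,j)}}$. Operation sequence and delay profile. A channel operation sequence is a permutation $\boldsymbol\pi=(\pi(1),\ldots,\pi(N^2))$ of $(1,\ldots,N^2)$; $\Pi$ is the set of all of them. A delay profile is a tuple $B=(b_{(\ell,i,j)}:(\ell,i,j)\in\mathcal{I}^3)$ with entries in $\{0,1\}$ ($b_{(\ell,i,j)}$ is the delay incurred by edge $(\ell,i)$ on edge $(i,j)$); $\mathbf{1}$ denotes the all-one delay profile. For $(i,j)\in\mathcal{E}$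 let $t_{(i,j)}$ be the unique integer with $(i,j)\in\Omega_{\pi(t_{(i,j)})}$. $B$ is feasible with respect to $\boldsymbol\pi$ if for all $(\ell,i,j)$: $b_{(\ell,i,j)}=0$ implies $t_{(\ell,i)}<t_{(i,j)}$. (So $\mathbf{1}$ is feasible with respect to every $\boldsymbol\pi$.) Code. For $\boldsymbol\pi\in\Pi$, $B$ feasible with respect to $\boldsymbol\pi$, and positive integers $n$ and $M_\mathcal{I}=(M_1,\ldots,M_N)$ with $M_i=1$ for $i\notin\mathcal{V}$, a $(\boldsymbol\pi,B,n,M_\mathcal{I})$-code consists of: message sets $\mathcal{W}_i=\{1,\ldots,M_i\}$, with messages $W_i$ uniform on $\mathcal{W}_i$ and independent across $i\in\mathcal{I}$; encoding functions $f_{(i,j),k}:\mathcal{W}_i\times\prod_{\ell\in\mathcal{I}}\mathcal{Y}_{(\ell,i)}^{k-b_{(\ell,i,j)}}\to\mathcal{X}_{(i,j)}$ for $(i,j)\in\mathcal{E}$, $1\le k\le n$, with $X_{(i,j),k}=f_{(i,j),k}(W_i,(Y_{(\ell,i)}^{k-b_{(\ell,i,j)}}:\ell\in\mathcal{I}))$; decoding functions $g_{i,j}:\mathcal{W}_j\times\mathcal{Y}_{\mathcal{I}\times\{j\}}^n\to\mathcal{W}_i$ for $(i,j)\in\mathcal{V}\times\mathcal{D}$, with $\hat W_{i,j}=g_{i,j}(W_j,Y^n_{\mathcal{I}\times\{j\}})$. Memorylessness and independence. For every $\boldsymbol\pi$ and every $(\boldsymbol\pi,B,n,M_\mathcal{I})$-code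 the following holds. With $U^{k-1}=(W_\mathcal{I},X_\mathcal{E}^{k-1},Y_\mathcal{E}^{k-1})$ and $\Omega_{\boldsymbol\pi}^h=\bigcup_{m=1}^h\Omega_{\pi(m)}$ ($\Omega_{\boldsymbol\pi}^0=\emptyset$), for all $k\in\{1,\ldots,n\}$, $h\in\{1,\ldots,N^2\}$ and all values of the variables, $$\Pr\{U^{k-1}=u^{k-1},X_{\Omega_{\boldsymbol\pi}^h,k}=x_{\Omega_{\boldsymbol\pi}^h,k},Y_{\Omega_{\boldsymbol\pi}^h,k}=y_{\Omega_{\boldsymbol\pi}^h,k}\}$$ $$=\Pr\{U^{k-1}=u^{k-1},X_{\Omega_{\boldsymbol\pi}^h,k}=x_{\Omega_{\boldsymbol\pi}^h,k},Y_{\Omega_{\boldsymbol\pi}^{h-1},k}=y_{\Omega_{\boldsymbol\pi}^{h-1},k}\}\;q^{(\pi(h))}(y_{\Omega_{\pi(h)},k}|x_{\Omega_{\pi(h)},k}).$$ Capacity. The error probability of a code is $P_{\text{err}}^n=\Pr\{\bigcup_{(i,j)\in\mathcal{V}\times\mathcal{D}}\{\hat W_{i,j}\neq W_i\}\}$. A rate tuple $R_\mathcal{I}=(R_1,\ldots,R_N)\in\mathbb{R}_+^N$ with $R_i=0$ for $i\notin\mathcal{V}$ is $(\boldsymbol\pi,B)$-achievable if there is a sequence of $(\boldsymbol\pi,B,n,M_\mathcal{I})$-codes ($n=1,2,\ldots$, $M_\mathcal{I}$ depending on $n$) with $\liminf_{n\to\infty}\frac{\log M_i}{n}\ge R_i$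 for all $i\in\mathcal{I}$ and $\lim_{n\to\infty}P_{\text{err}}^n=0$. $\mathcal{C}_B^{\boldsymbol\pi}$ is the set of $(\boldsymbol\pi,B)$-achievable rate tuples; the capacity region is $\mathcal{C}=\bigcup_{\boldsymbol\pi\in\Pi}\bigcup_{B\text{ feasible w.r.t. }\boldsymbol\pi}\mathcal{C}_B^{\boldsymbol\pi}$. The $\mathbf{1}$-capacity region is $\mathcal{C}^{\mathbf{1}}=\bigcup_{\boldsymbol\pi\in\Pi}\mathcal{C}_{\mathbf{1}}^{\boldsymbol\pi}$, the set of rate tuples achievable when every edge incurs a unit delay on every adjacent edge (the set $\mathcal{C}_{\mathbf{1}}^{\boldsymbol\pi}$ does not depend on $\boldsymbol\pi$). *)

(* Defs.v *)
(* MathComp / MathComp-Analysis.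

   Discrete memoryless networks made of independent channels, one per directed
   edge, with operation sequences and {0,1} delay profiles.

   Nodes 1..N are 'I_N and times 1..n are 'I_n, both counted from 0. *)
From HB Require Import structures.
From mathcomp Require Import all_boot all_order all_algebra all_fingroup.
From mathcomp Require Import all_classical all_reals all_analysis.

Set Implicit Arguments.
Unset Strict Implicit.
Unset Printing Implicit Defensive.

Import Order.TTheory GRing.Theory Num.Theory.
Import numFieldNormedType.Exports.

Local Open Scope classical_set_scope.
Local Open Scope ring_scope.

Section Finite_probability.
Variable R : realType.

Definition is_pmf (T : finType) (p : T -> R) : Prop :=
  (forall t, 0 <= p t) /\ \sum_t p t = 1.

Definition Pr (T : finType) (p : T -> R) (A : pred T) : R :=
  \sum_(t | A t) p t.

Definition log2 (x : R) : R := ln x / ln 2.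

(* Terms with p (a, b) = 0 vanish, whatever the value of log2 there, which is
   the convention 0 log 0 = 0. *)
Definition mutual_info (A B : finType) (p : A * B -> R) : R :=
  \sum_a \sum_b
    p (a, b) * log2 (p (a, b) / ((\sum_b' p (a, b')) * (\sum_a' p (a', b)))).

End Finite_probability.

Definition edge (N : nat) : finType := ('I_N * 'I_N)%type.

Record network (R : realType) (N : nat) := Network {
  inp : edge N -> finType;
  out : edge N -> finType;
  chan : forall e : edge N, inp e -> out e -> R;
  inp_gt0 : forall e, (0 < #|inp e|)%N;
  chan_pmf : forall e (x : inp e), is_pmf (chan x)
}.
Arguments chan {R N} _ _ _ _.

(* The mutual information is continuous on the compact simplex of input
   distributions, so this supremum is a maximum. *)
Definition capacity (R : realType) (N : nat) (net : network R N) (e : edge N) :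
    R :=
  sup [set mutual_info (fun xy : inp net e * out net e =>
                          p xy.1 * chan net e xy.1 xy.2)
      | p in [set p : inp net e -> R | is_pmf p]].

Section Operation.
Variable N : nat.

Lemma edge_index_subproof (e : edge N) : (N * e.1 + e.2 < N ^ 2)%N.
Proof.
case: e => i j /=; rewrite -mulnn.
apply: (@leq_trans (N * i.+1)); rewrite ?leq_mul2l ?ltn_ord ?orbT //.
by rewrite mulnS addnC ltn_add2r.
Qed.

Definition edge_index (e : edge N) : 'I_(N ^ 2) :=
  Ordinal (edge_index_subproof e).

Definition Omega (m : 'I_(N ^ 2)) : {set edge N} :=
  finset (fun e => edge_index e == m).

Definition Omega_upto (pi : 'S_(N ^ 2)) (h : nat) : {set edge N} :=
  (\bigcup_(m < N ^ 2 | (m < h)%N) Omega (pi m))%SET.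

(* The position t such that e \in Omega (pi t). *)
Definition position (pi : 'S_(N ^ 2)) (e : edge N) : 'I_(N ^ 2) :=
  (pi^-1)%g (edge_index e).

(* B l i j is the delay incurred by edge (l, i) on edge (i, j); the Boolean is
   used as the number 0 or 1. *)
Definition delay_profile := 'I_N -> 'I_N -> 'I_N -> bool.

Definition all_one : delay_profile := fun _ _ _ => true.

Definition feasible (pi : 'S_(N ^ 2)) (B : delay_profile) : Prop :=
  forall l i j : 'I_N,
    B l i j = false -> (position pi (l, i) < position pi (i, j))%N.

End Operation.
Arguments all_one {N}.

Section Codes.
Variables (R : realType) (N : nat) (net : network R N).
Variables V D : {set 'I_N}.

(* k : 'I_n stands for time k + 1, so the encoder of edge (i, j) sees the first
   k + 1 - B l i j outputs of edge (l, i). Decoders are given for all pairs,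
   but only those in V x D enter the error event. *)
Record net_code (B : delay_profile N) (n : nat) := NetCode {
  msize : 'I_N -> nat;
  msize_gt0 : forall i, (0 < msize i)%N;
  msize_notin : forall i, i \notin V -> msize i = 1%N;
  enc : forall (i j : 'I_N) (k : 'I_n),
    'I_(msize i) ->
    (forall l : 'I_N, (k.+1 - B l i j)%N.-tuple (out net (l, i))) ->
    inp net (i, j);
  dec : forall i j : 'I_N,
    'I_(msize j) -> (forall l : 'I_N, n.-tuple (out net (l, j))) ->
    'I_(msize i)
}.

Lemma prefix_subproof (n : nat) (k : 'I_n) (b : nat) : (k.+1 - b <= n)%N.
Proof. exact: leq_trans (leq_subr _ _) (ltn_ord k). Qed.

Definition out_prefix (T : Type) (n : nat) (k : 'I_n) (b : nat) (y : 'I_n -> T) :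
    (k.+1 - b)%N.-tuple T :=
  [tuple y (widen_ord (prefix_subproof k b) s) | s < (k.+1 - b)%N].

(* The random variables generated by a code, on a finite sample space. When B
   is feasible for pi, the conditions below determine the joint law of the
   messages, inputs and outputs. In [memoryless], only the values of [x] and
   [y] at times before k, and at time k on the edges operated so far, are
   used. *)
Record realization (pi : 'S_(N ^ 2)) (B : delay_profile N) (n : nat)
    (c : net_code B n) := Realization {
  sample_space : finType;
  prob : sample_space -> R;
  Wv : forall i : 'I_N, sample_space -> 'I_(msize c i);
  Xv : forall e : edge N, 'I_n -> sample_space -> inp net e;
  Yv : forall e : edge N, 'I_n -> sample_space -> out net e;
  prob_pmf : is_pmf prob;
  message_uniform : forall (i : 'I_N) (w : 'I_(msize c i)),
    Pr prob (fun o => Wv i o == w) = (msize c i)%:R^-1;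
  message_indep : forall w : (forall i : 'I_N, 'I_(msize c i)),
    Pr prob (fun o => [forall i, Wv i o == w i]) =
    \prod_i Pr prob (fun o => Wv i o == w i);
  encoding : forall (i j : 'I_N) (k : 'I_n) (o : sample_space),
    Xv (i, j) k o =
    enc (Wv i o)
      (fun l => out_prefix k (B l i j) (fun s => Yv (l, i) s o));
  memoryless : forall (k : 'I_n) (h : 'I_(N ^ 2))
      (w : forall i : 'I_N, 'I_(msize c i))
      (x : forall e : edge N, 'I_n -> inp net e)
      (y : forall e : edge N, 'I_n -> out net e),
    let past o :=
      [forall i, Wv i o == w i] &&
      [forall e, [forall s : 'I_n, (s < k)%N ==>
         ((Xv e s o == x e s) && (Yv e s o == y e s))]] in
    let X_on (S : {set edge N}) o := [forall (e | e \in S), Xv e k o == x e k] in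
    let Y_on (S : {set edge N}) o := [forall (e | e \in S), Yv e k o == y e k] in
    forall e : edge N, e \in Omega (pi h) ->
    Pr prob (fun o => [&& past o, X_on (Omega_upto pi h.+1) o
                        & Y_on (Omega_upto pi h.+1) o]) =
    Pr prob (fun o => [&& past o, X_on (Omega_upto pi h.+1) o
                        & Y_on (Omega_upto pi h) o]) *
    chan net e (x e k) (y e k)
}.

Definition decoded (pi : 'S_(N ^ 2)) (B : delay_profile N) (n : nat)
    (c : net_code B n) (r : realization pi c) (i j : 'I_N) (o : sample_space r) :
    'I_(msize c i) :=
  dec i (Wv j o) (fun l => [tuple Yv (l, j) s o | s < n]).

Definition error_prob (pi : 'S_(N ^ 2)) (B : delay_profile N) (n : nat)
    (c : net_code B n) (r : realization pi c) : R :=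
  Pr (@prob _ _ _ _ r)
    (fun o => [exists (i | i \in V), exists (j | j \in D),
                 decoded i j o != Wv i o]).

Definition rate_tuples : set ('I_N -> R) :=
  [set r | (forall i, 0 <= r i) /\ (forall i, i \notin V -> r i = 0)].

(* The term of index n of a sequence of codes has blocklength n + 1. *)
Definition achievable (pi : 'S_(N ^ 2)) (B : delay_profile N) :
    set ('I_N -> R) :=
  [set r | rate_tuples r /\
    exists (c : forall n : nat, net_code B n.+1)
           (rv : forall n : nat, realization pi (c n)),
      (forall i : 'I_N,
         ((r i)%:E <=
          limn_einf (fun n => (log2 ((msize (c n) i)%:R : R) / n.+1%:R)%:E))%E)
      /\ (fun n => error_prob (rv n)) @ \oo --> (0 : R)].

Definition capacity_region : set ('I_N -> R) :=
  \bigcup_(pi in [set: 'S_(N ^ 2)])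
    \bigcup_(B in [set B | feasible pi B]) achievable pi B.

Definition capacity_region_one : set ('I_N -> R) :=
  \bigcup_(pi in [set: 'S_(N ^ 2)]) achievable pi all_one.

(* Intersecting with [rate_tuples] fixes the ambient set, also when no T
   satisfies the condition (D empty). *)
Definition cutset_region : set ('I_N -> R) :=
  rate_tuples `&`
  \bigcap_(T in [set T : {set 'I_N} | (~: T :&: D)%SET != finset.set0])
    [set r | \sum_(i in T) r i <=
             \sum_(e in finset.setX T (~: T)%SET) capacity net e].

End Codes.

(* Main.v *)
Require Import Defs.
From mathcomp Require Import all_boot all_order all_algebra all_fingroup.
From mathcomp Require Import all_classical all_reals all_analysis.
From mathcomp Require Import ring lra zify.

(* Proof idea.

   Converse. Fix a cut T and a destination outside T. Compare the true law with
   the one under which each edge from T to its complement emits, independently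
   of everything else, its true output marginal. The log-likelihood ratio has
   expectation the sum of the mutual informations across the cut, while under
   the second law the messages of T are guessed with probability at most one
   over their number. Jensen's inequality for ln applied to the likelihood ratio
   gives the weak converse directly, and the operation sequence only serves to
   peel off the channel uses one by one, so zero-delay edges are harmless.

   Achievability. Feinstein's greedy construction turns each edge into a nearly
   noiseless link of rate close to its capacity, over blocks of length m. Over
   L blocks, in each block every node sends on each outgoing link a fresh random
   function of its message and of everything it decoded in earlier blocks, hence
   with unit delays. For two message tuples, the set of nodes that tell them
   apart either grows, at most N times, or stays equal to some T, which costs a
   factor exp (- m * capacity across T) per block; this beats the union bound
   over message tuples for L large, then m large. *)

Set Implicit Arguments.
Unset Strict Implicit.
Unset Printing Implicit Defensive.

Import Order.TTheory GRing.Theory Num.Theory.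
Import numFieldNormedType.Exports.

Local Open Scope ring_scope.

(** * Product distributions and causal recursions *)

(** Conditional probabilities are avoided. The achieving codes live on one table of independent
    noise entries, and a random link code is another such table; independence is used mostly through
    [resample], which redraws some entries and keeps the rest. In the converse the sample space is
    given and has no such structure, so a channel use is integrated out by summing over the classes
    of equal history, and the comparison law is never built as a measure: it exists only as the
    density [weight] against the true law.

    A relayed symbol depends on messages, noise and the random code, so its distribution is not
    controlled; the link codes therefore need small maximal error, which the greedy construction
    supplies. Cycles in the network are harmless because the set of nodes that tell two tuples apart
    never shrinks. The blocks in which it grows contribute no cut factor; a slack [d] in the rates
    pays for them. *)

Section ProductPmf.
Variables (R : realType) (I Z : finType) (p : I -> Z -> R).
Hypothesis p_pmf : forall i, is_pmf (p i).

Definition prod_pmf (u : {ffun I -> Z}) : R := \prod_i p i (u i).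

Lemma prod_pmf_ge0 u : 0 <= prod_pmf u.
Proof. by apply: prodr_ge0 => i _; case: (p_pmf i). Qed.

Lemma prod_pmf_is_pmf : is_pmf prod_pmf.
Proof.
split; first exact: prod_pmf_ge0.
rewrite /prod_pmf -(bigA_distr_bigA (fun i z => p i z)).
by apply: big1 => i _; case: (p_pmf i).
Qed.

Definition mix (J : {set I}) (v u : {ffun I -> Z}) : {ffun I -> Z} :=
  [ffun i => if i \in J then v i else u i].

Lemma mix_in (J : {set I}) v u i : i \in J -> mix J v u i = v i.
Proof. by rewrite ffunE => ->. Qed.

Lemma mix_notin (J : {set I}) v u i : i \notin J -> mix J v u i = u i.
Proof. by rewrite ffunE => /negPf ->. Qed.

(* The map [(u, v) |-> (mix J v u, mix J u v)] swaps the coordinates in [J] of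
   two independent copies; it is an involution preserving the product law. *)
Lemma resample (J : {set I}) (f : {ffun I -> Z} -> R) :
  \sum_u prod_pmf u * f u =
  \sum_u prod_pmf u * \sum_v prod_pmf v * f (mix J v u).
Proof.
have [_ p1] := prod_pmf_is_pmf.
transitivity (\sum_(x : {ffun I -> Z} * {ffun I -> Z})
    prod_pmf x.1 * prod_pmf x.2 * f x.1).
  rewrite -(pair_big xpredT xpredT
    (fun a b => prod_pmf a * prod_pmf b * f a)) /=.
  apply: eq_bigr => u _; rewrite -[LHS]mul1r -p1 mulr_suml.
  by apply: eq_bigr => v _; rewrite mulrCA mulrA.
under [RHS]eq_bigr => u _ do rewrite mulr_sumr.
rewrite pair_big /=.
pose sw (x : {ffun I -> Z} * {ffun I -> Z}) := (mix J x.2 x.1, mix J x.1 x.2).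
have swK : involutive sw.
  move=> [u v]; congr pair; apply/ffunP => i;
    by rewrite /sw /= !ffunE; case: ifP => //= ->.
rewrite (reindex_inj (inv_inj swK)) /=.
apply: eq_bigr => -[u v] _ /=; rewrite mulrA; congr (_ * _).
rewrite /prod_pmf -!big_split /=; apply: eq_bigr => i _.
by rewrite !ffunE; case: ifP => //; rewrite mulrC.
Qed.

(** The coordinates read are distinct, so the fibre over [y] is a box: [Q i] constrains coordinate
    [i] if it is read and is everything otherwise. The product law of a box factorises. *)
Lemma prod_pmf_marginal (K Y : finType) (idx : K -> I) (dec : Z -> Y)
    (F : {ffun K -> Y} -> R) : injective idx ->
  \sum_(u : {ffun I -> Z}) prod_pmf u * F [ffun k => dec (u (idx k))] =
  \sum_(y : {ffun K -> Y})
     (\prod_k \sum_(z | dec z == y k) p (idx k) z) * F y.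
Proof.
move=> idx_inj.
rewrite (partition_big (fun u : {ffun I -> Z} => [ffun k => dec (u (idx k))])
  xpredT) //=.
apply: eq_bigr => y _.
transitivity (\sum_(u : {ffun I -> Z} | [ffun k => dec (u (idx k))] == y) prod_pmf u * F y).
  by apply: eq_bigr => u /eqP ->.
rewrite -mulr_suml; congr (_ * _).
pose Q i : pred Z := fun z => [forall k, (idx k == i) ==> (dec z == y k)].
transitivity (\sum_(u in family Q) prod_pmf u).
  apply: eq_bigl => u; apply/eqP/familyP => [uy i|uQ].
    by apply/forallP => k; apply/implyP => /eqP <-; rewrite -uy ffunE.
  apply/ffunP => k; rewrite ffunE.
  by have /forallP/(_ k) := uQ (idx k); rewrite eqxx /= => /eqP.
rewrite /prod_pmf -(bigA_distr_big_dep _ (fun i z => p i z)).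
rewrite (bigID (mem [set idx k | k in [set: K]]%SET)) /=.
rewrite [X in _ * X]big1 ?mulr1; last first.
  move=> i iN; rewrite -[RHS](proj2 (p_pmf i)); apply: eq_bigl => z.
  apply/forallP => k; apply/implyP => /eqP ki.
  by rewrite -ki imset_f ?inE in iN.
rewrite (big_imset (fun i => \sum_(z | Q i z) p i z)) /=; last first.
  by move=> a b _ _; apply: idx_inj.
apply: eq_big => [k|k _]; first by rewrite inE.
apply: eq_bigl => z; apply/forallP/idP => [/(_ k)|zy j].
  by rewrite eqxx.
by apply/implyP => /eqP/idx_inj ->.
Qed.

Lemma prod_pmf_expect1 (i : I) (h : Z -> R) :
  \sum_(u : {ffun I -> Z}) prod_pmf u * h (u i) = \sum_z p i z * h z.
Proof.
pose F j z := p j z * (if j == i then h z else 1).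
transitivity (\sum_(u : {ffun I -> Z}) \prod_j F j (u j)).
  apply: eq_bigr => u _; rewrite big_split /=; congr (_ * _).
  by rewrite -big_mkcond /= big_pred1_eq.
rewrite -(bigA_distr_bigA F) (bigD1 i) //= [X in _ * X]big1 ?mulr1.
  by apply: eq_bigr => z _; rewrite /F eqxx.
move=> j /negPf ji; rewrite -[RHS](proj2 (p_pmf j)).
by apply: eq_bigr => z _; rewrite /F ji mulr1.
Qed.

(** No coordinate [c k] with [k] in [E] is among the [c' k'], so redrawing the latter leaves the
    values to be matched fixed. The matches are then independent events. *)
Lemma prod_pmf_collision (K : finType) (E : {set K}) (c c' : K -> I)
    (bd : K -> R) : injective c' ->
  {in E &, forall k k', c k != c' k'} ->
  (forall k z, k \in E -> p (c' k) z <= bd k) ->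
  \sum_(v : {ffun I -> Z})
    prod_pmf v * [forall (k | k \in E), v (c k) == v (c' k)]%:R <=
  \prod_(k in E) bd k.
Proof.
move=> c'_inj cc' le_bd; rewrite (resample [set c' k | k in E]%SET).
rewrite -[leRHS]mul1r -[X in X * _](proj2 prod_pmf_is_pmf) mulr_suml ler_sum // => u _.
rewrite ler_wpM2l ?prod_pmf_ge0 //.
pose F (y : {ffun K -> Z}) : R := [forall (k | k \in E), u (c k) == y k]%:R.
rewrite (eq_bigr (fun v : {ffun I -> Z} =>
  prod_pmf v * F [ffun k => id (v (c' k))])); last first.
  move=> v _; rewrite /F; congr (_ * (nat_of_bool _)%:R); apply: eq_forallb => k.
  case: (boolP (k \in E)) => //= kE.
  rewrite mix_notin; last by apply/imsetP => -[k' k'E]; apply/eqP/cc'.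
  by rewrite mix_in ?imset_f // ffunE.
rewrite (prod_pmf_marginal id F) //.
rewrite (_ : (\sum_y _)%R = \sum_(y : {ffun K -> Z})
    \prod_k (p (c' k) (y k) * ((k \in E) ==> (u (c k) == y k))%:R)); last first.
  apply: eq_bigr => y _; rewrite big_split /=; congr (_ * _).
    by apply: eq_bigr => k _; rewrite big_pred1_eq.
  rewrite /F; case: forallP => [h|/forallP/forallPn[k h]].
    by rewrite big1 // => k _; rewrite h.
  by rewrite (bigD1 k) //= (negPf h) mul0r.
rewrite -(bigA_distr_bigA (fun k z =>
  p (c' k) z * ((k \in E) ==> (u (c k) == z))%:R)) /=.
rewrite [leRHS]big_mkcond /=; apply: ler_prod => k _.
have [p0 p1] := p_pmf (c' k).
apply/andP; split; first by apply: sumr_ge0 => z _; rewrite mulr_ge0.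
case: (boolP (k \in E)) => kE /=.
  rewrite (bigD1 (u (c k))) //= eqxx mulr1 big1 ?addr0; first exact: le_bd.
  by move=> z; rewrite eq_sym => /negPf ->; rewrite mulr0.
by under eq_bigr => z _ do rewrite mulr1; rewrite p1.
Qed.
End ProductPmf.

(** The averaging principle, with a point of positive mass. Positivity will force every symbol of
    the chosen link code to be one that can be transmitted. *)
Lemma is_pmf_support (R : realType) (T : finType) (mu f : T -> R) (a : R) :
  is_pmf mu -> \sum_t mu t * f t <= a -> exists2 t, 0 < mu t & f t <= a.
Proof.
move=> [mu0 mu1] le_a; apply: contrapT => no.
have lt_f t : 0 < mu t -> a < f t.
  by move=> t0; rewrite ltNge; apply/negP => ?; apply: no; exists t.
have [t /andP[_ t_gt0]] : exists t, xpredT t && (0 < mu t).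
  by apply: psumr_neq0P => //; rewrite mu1; apply/eqP/oner_neq0.
have ge0 t' : true -> 0 <= mu t' * (f t' - a).
  move=> _; have := mu0 t'; rewrite le_eqVlt => /predU1P[<-|t'0].
    by rewrite mul0r.
  by rewrite mulr_ge0 ?mu0 // subr_ge0 ltW // lt_f.
have eq0 : \sum_t' mu t' * (f t' - a) = 0.
  apply/eqP; rewrite eq_le sumr_ge0 ?andbT //.
  under eq_bigr => t' _ do rewrite mulrBr.
  by rewrite sumrB -mulr_suml mu1 mul1r subr_le0.
have /eqP := psumr_eq0P ge0 eq0 (erefl true) : mu t * (f t - a) = 0.
by rewrite mulf_eq0 gt_eqF //= subr_eq0 gt_eqF // lt_f.
Qed.

(** * Strictly causal recursions in discrete time *)

Section CausalRecursion.
Variables (n : nat) (T : Type) (t0 : T).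

(** Strict causality: the value at time [k] sees only earlier times, which makes the fixed point of
    the recursion exist and be unique. *)
Definition causal (F : 'I_n -> ('I_n -> T) -> T) :=
  forall (k : 'I_n) (y y' : 'I_n -> T),
    (forall s : 'I_n, (s < k)%N -> y s = y' s) -> F k y = F k y'.

Fixpoint causal_iter (F : 'I_n -> ('I_n -> T) -> T) (t : nat) : 'I_n -> T :=
  if t is t'.+1 then
    fun s => if s == t' :> nat then F s (causal_iter F t') else causal_iter F t' s
  else fun=> t0.

Definition causal_sol F : 'I_n -> T := causal_iter F n.

Lemma causal_iter_stable F t t' (s : 'I_n) :
  (s < t)%N -> (t <= t')%N -> causal_iter F t' s = causal_iter F t s.
Proof.
move=> st; elim: t' => [|t' IH]; first by rewrite leqn0 => /eqP ->.
rewrite leq_eqVlt => /orP[/eqP -> //|]; rewrite ltnS => tt'.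
rewrite /= ifN ?IH //; apply/eqP => st'.
by move: (leq_trans st tt'); rewrite st' ltnn.
Qed.

Lemma causal_solE F k : causal F -> causal_sol F k = F k (causal_sol F).
Proof.
move=> cF; rewrite /causal_sol (@causal_iter_stable F k.+1 n k) //=.
rewrite eqxx; apply: cF => s sk.
by rewrite (@causal_iter_stable F k n s) // ltnW.
Qed.

(** Uniqueness on an initial segment serves to compare two runs whose noise or code agrees up to
    time [m] and differs later. *)
Lemma causal_sol_unique_upto F (y : 'I_n -> T) (m : nat) : causal F ->
  (forall s : 'I_n, (s < m)%N -> y s = F s y) ->
  forall s : 'I_n, (s < m)%N -> y s = causal_sol F s.
Proof.
move=> cF yF s; move: {2}(s : nat) (leqnn s) => t; elim: t s => [|t IH] s st sm.
all: rewrite yF // causal_solE //; apply: cF => s' s's.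
  by move: (leq_trans s's st).
apply: IH; first by rewrite -ltnS (leq_trans s's).
exact: ltn_trans s's sm.
Qed.

End CausalRecursion.

(** * Realizing codes with unit delays *)

Lemma position_Omega N (pi : 'S_(N ^ 2)) (e : edge N) h :
  (e \in Omega (pi h)) = (position pi e == h).
Proof.
rewrite inE /position; apply/eqP/eqP => [->|<-]; first by rewrite permK.
by rewrite permKV.
Qed.

Lemma position_Omega_upto N (pi : 'S_(N ^ 2)) (e : edge N) h :
  (e \in Omega_upto pi h) = (position pi e < h)%N.
Proof.
apply/bigcupP/idP => [[m mh]|lt_h].
  by rewrite position_Omega => /eqP ->.
by exists (position pi e) => //; rewrite position_Omega.
Qed.

Lemma position_inj N (pi : 'S_(N ^ 2)) : injective (position pi).
Proof.
move=> [i j] [i' j'] /perm_inj/(congr1 val) /= eq_idx.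
have N0 : (0 < N)%N by apply: leq_ltn_trans (ltn_ord i).
(* The index is [N * i + j] with [j < N]: quotient and remainder by [N] recover the edge. *)
have := congr1 (divn^~ N) eq_idx; have := congr1 (modn^~ N) eq_idx.
rewrite /= ![(N * _)%N]mulnC !modnMDl !divnMDl // !modn_small ?divn_small //.
by rewrite !addn0 => /val_inj -> /val_inj ->.
Qed.

Lemma forall_Omega_uptoS N (pi : 'S_(N ^ 2)) (e : edge N) (A : pred (edge N)) :
  [forall (e' | e' \in Omega_upto pi (position pi e).+1), A e'] =
  [forall (e' | e' \in Omega_upto pi (position pi e)), A e'] && A e.
Proof.
apply/forallP/andP => [Ah|[/forallP Ah Ae] e'].
  split; last by have := Ah e; rewrite position_Omega_upto ltnSn.
  apply/forallP => e'; apply/implyP; rewrite position_Omega_upto => e'h.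
  by have := Ah e'; rewrite position_Omega_upto ltnS ltnW.
apply/implyP; rewrite position_Omega_upto ltnS leq_eqVlt => /orP[e'h|e'h].
  by have -> : e' = e by apply: (@position_inj _ pi); apply: val_inj; apply/eqP.
by have := Ah e'; rewrite position_Omega_upto e'h.
Qed.

(** * A common alphabet for outputs and noise *)

Section Letters.
Variables (R : realType) (N : nat) (net : network R N).

Lemma inp_inhabited e : exists x : inp net e, true.
Proof. by have /card_gt0P[x _] := inp_gt0 net e; exists x. Qed.

Definition inp0 e : inp net e := xchoose (inp_inhabited e).

(** Output alphabets are not assumed inhabited; a row of the channel sums to 1, so some output has
    positive probability. *)
Lemma out_inhabited e : exists y : out net e, true.
Proof.
have [_ chan1] := chan_pmf (inp0 e).
have [y _] : exists y, xpredT y && (0 < chan net e (inp0 e) y).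
  apply: psumr_neq0P => [y _|]; first by case: (chan_pmf (inp0 e)).
  by rewrite chan1; apply/eqP/oner_neq0.
by exists y.
Qed.

Definition out0 e : out net e := xchoose (out_inhabited e).

(** One type for the outputs of all edges, since the coordinates of [prod_pmf] share their value
    type. *)
Definition letter : finType := {e : edge N & out net e}.

Definition to_letter e (y : out net e) : letter := Tagged (fun e => out net e) y.

Definition of_letter e (z : letter) : out net e :=
  odflt (out0 e) [pick y | to_letter y == z].

Lemma to_letterK e : cancel (@to_letter e) (@of_letter e).
Proof.
move=> y; rewrite /of_letter; case: pickP => [y'|/(_ y)]; last by rewrite eqxx.
by rewrite /to_letter eq_Tagged /= => /eqP.
Qed.

(* The randomness of an edge at a given time is a choice of output for each
   input letter. *)
Definition noise_law (a : {e : edge N & inp net e}) (z : letter) : R :=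
  \sum_y chan net (tag a) (tagged a) y * (to_letter y == z)%:R.

Lemma noise_law_pmf a : is_pmf (noise_law a).
Proof.
have [chan0 chan1] := chan_pmf (tagged a); split=> [z|].
  by apply: sumr_ge0 => y _; rewrite mulr_ge0.
rewrite exchange_big /= -[RHS]chan1; apply: eq_bigr => y _.
rewrite -mulr_sumr (bigD1 (to_letter y)) //= eqxx [X in _ + X]big1 ?addr0 ?mulr1 // => z.
by rewrite eq_sym => /negPf ->.
Qed.

Lemma noise_law_of_letter e (x : inp net e) y :
  \sum_(z | of_letter e z == y)
     noise_law (Tagged (fun e => inp net e) x) z = chan net e x y.
Proof.
rewrite exchange_big /= (bigD1 y) //= [X in _ + X]big1 ?addr0 => [|y' ne].
  rewrite (bigD1 (to_letter y)) ?to_letterK //= eqxx mulr1.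
  by rewrite [X in _ + X]big1 ?addr0 // => z /andP[_]; rewrite eq_sym => /negPf ->; rewrite mulr0.
apply: big1 => z /eqP zy; case: eqP => [yz|]; last by rewrite mulr0.
by move: zy ne; rewrite -yz to_letterK => ->; rewrite eqxx.
Qed.

End Letters.
Arguments to_letter {R N net e}.

Section CodeInput.
Variables (R : realType) (N : nat) (net : network R N) (V : {set 'I_N}).
Variables (B : delay_profile N) (n : nat) (c : net_code net V B n).

Definition code_input (w : forall i, 'I_(msize c i))
    (y : forall e, 'I_n -> out net e) (e : edge N) (k : 'I_n) : inp net e :=
  let: (i, j) as e0 := e return inp net e0 in
  enc (w i) (fun l => out_prefix k (B l i j) (y (l, i))).

Lemma code_input_ext w w' y y' (i j : 'I_N) (k : 'I_n) : w i = w' i ->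
  (forall l (s : 'I_n), (s < k.+1 - B l i j)%N -> y (l, i) s = y' (l, i) s) ->
  code_input w y (i, j) k = code_input w' y' (i, j) k.
Proof.
move=> /= -> yy'; congr (enc _ _).
apply: functional_extensionality_dep => l.
by apply: eq_from_tnth => s; rewrite !tnth_mktuple; apply: yy' => /=.
Qed.
End CodeInput.

(** * Counting message tuples *)

Section Messages.
Variables (N : nat) (M : 'I_N -> nat).

Definition messages : finType := {dffun forall i : 'I_N, 'I_(M i)}.

Lemma card_messages : #|messages| = (\prod_i M i)%N.
Proof.
rewrite card_dep_ffun foldrE big_map big_enum /=.
by apply: eq_bigr => i _; rewrite card_ord.
Qed.

Lemma messages_gt0 : (forall i, (0 < M i)%N) -> (0 < #|messages|)%N.
Proof. by move=> M_gt0; rewrite card_messages prodn_gt0. Qed.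

Lemma card_message_eq i (v : 'I_(M i)) :
  (#|[set w : messages | w i == v]%SET| * M i)%N = #|messages|.
Proof.
(* [u] and [v] have different types until [j = i] is known, hence the comparison as natural
   numbers. *)
pose F (j : 'I_N) : pred 'I_(M j) :=
  fun u => (j == i) ==> (nat_of_ord u == nat_of_ord v).
have -> : #|[set w : messages | w i == v]%SET| = (\prod_j #|F j|)%N.
  have := card_family F; rewrite foldrE big_map big_enum /= => <-.
  apply: eq_card => w; rewrite inE.
  apply/eqP/familyP => [wi j|/(_ i)]; rewrite unfold_in /F.
    by apply/implyP => /eqP ji; subst j; rewrite wi.
  by rewrite eqxx => /eqP/val_inj.
rewrite card_messages (bigD1 i) //= [RHS](bigD1 i) //= mulnC; congr muln.
rewrite -[RHS]mul1n; congr muln.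
  rewrite -(card1 v).
  by apply: eq_card => u; rewrite !unfold_in /F eqxx.
apply: eq_bigr => j /negPf ji; rewrite -[RHS]card_ord; apply: eq_card => u.
by rewrite unfold_in /F ji.
Qed.

Definition agree_off (T : {set 'I_N}) (w : messages) : {set messages} :=
  [set w' : messages | [forall i, (i \notin T) ==> (w' i == w i)]]%SET.

Lemma agree_off_sym T w w' : (w \in agree_off T w') = (w' \in agree_off T w).
Proof. by rewrite !inE; apply: eq_forallb => i; rewrite eq_sym. Qed.

Lemma card_agree_off T w : #|agree_off T w| = (\prod_(i in T) M i)%N.
Proof.
pose F (j : 'I_N) : pred 'I_(M j) := fun u => (j \notin T) ==> (u == w j).
have -> : #|agree_off T w| = (\prod_j #|F j|)%N.
  have := card_family F; rewrite foldrE big_map big_enum /= => <-.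
  apply: eq_card => w'; rewrite inE.
  by apply/forallP/familyP => h i; have := h i.
rewrite [RHS]big_mkcond /=; apply: eq_bigr => j _; case: ifPn => jT.
  rewrite -[RHS]card_ord; apply: eq_card => u.
  by rewrite unfold_in /F jT.
by rewrite -(card1 (w j)); apply: eq_card => u; rewrite unfold_in /F jT.
Qed.

End Messages.

(** * The canonical sample space of a unit-delay code *)

Section Realize.
Variables (R : realType) (N : nat) (net : network R N) (V : {set 'I_N}).
Variables (n : nat) (c : net_code net V all_one n) (pi : 'S_(N ^ 2)).

Notation input_letter := {e : edge N & inp net e}.
(** One independent entry for each time and input letter, of which only the entry of the letter
    actually sent is read. Memorylessness thus reduces to independence of coordinates. *)
Definition noise : finType := {ffun 'I_n * input_letter -> letter net}.
Definition noise_coord_law (a : 'I_n * input_letter) : letter net -> R :=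
  noise_law a.2.

Notation mu := (prod_pmf noise_coord_law).

Lemma noise_coord_law_pmf a : is_pmf (noise_coord_law a).
Proof. exact: noise_law_pmf. Qed.

Definition noise_coord (e : edge N) (k : 'I_n) (x : inp net e) :
    'I_n * input_letter := (k, Tagged (fun e => inp net e) x).

Definition channel_step w (u : noise) (k : 'I_n)
    (y : 'I_n -> forall e, out net e) : forall e, out net e :=
  fun e => of_letter e (u (noise_coord k
    (@code_input _ _ _ _ _ _ c w (fun e s => y s e) e k))).

(** Unit delays enter here: inputs at time [k] use outputs of earlier times only, so all edges
    advance together, whatever the operation sequence. *)
Lemma channel_step_causal w u : causal (channel_step w u).
Proof.
move=> k y y' yy'; apply: functional_extensionality_dep => -[i j].
congr (of_letter _ (u (noise_coord _ _))); apply: code_input_ext => // l s.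
by rewrite subn1 => /yy' ->.
Qed.

Definition out_seq w u e k : out net e :=
  causal_sol (@out0 _ _ net) (channel_step w u) k e.

Definition in_seq w u e k : inp net e := code_input w (out_seq w u) e k.

Lemma out_seqE w u e k :
  out_seq w u e k = of_letter e (u (noise_coord k (in_seq w u e k))).
Proof. by rewrite {1}/out_seq causal_solE //; apply: channel_step_causal. Qed.

Lemma out_seq_ext w (u u' : noise) (m : nat) :
  (forall (s : 'I_n) a, (s < m)%N -> u (s, a) = u' (s, a)) ->
  forall e (s : 'I_n), (s < m)%N -> out_seq w u e s = out_seq w u' e s.
Proof.
move=> uu' e s sm; rewrite /out_seq.
rewrite (@causal_sol_unique_upto _ _ (@out0 _ _ net) (channel_step w u')
  (causal_sol (@out0 _ _ net) (channel_step w u)) m) //.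
  exact: channel_step_causal.
move=> {}s {}sm; rewrite causal_solE; last exact: channel_step_causal.
by apply: functional_extensionality_dep => {}e; rewrite /channel_step uu'.
Qed.

(** Reaches one time further than for outputs: the input at time [m] uses only outputs before
    [m]. *)
Lemma in_seq_ext w (u u' : noise) (m : nat) :
  (forall (s : 'I_n) a, (s < m)%N -> u (s, a) = u' (s, a)) ->
  forall e (s : 'I_n), (s <= m)%N -> in_seq w u e s = in_seq w u' e s.
Proof.
move=> uu' [i j] s sm; apply: code_input_ext => // l t.
by rewrite subn1 => ts; apply: (out_seq_ext _ uu'); apply: leq_trans sm.
Qed.

Definition omega : finType := (messages (msize c) * noise)%type.
Definition omega_law (o : omega) : R :=
  #|messages (msize c)|%:R^-1 * mu o.2.

Lemma Pr_omega (A : pred omega) :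
  Pr omega_law A =
  #|messages (msize c)|%:R^-1 * \sum_w \sum_u mu u * (A (w, u))%:R.
Proof.
rewrite /Pr big_mkcond /= mulr_sumr.
under [RHS]eq_bigr => w _ do rewrite mulr_sumr.
rewrite pair_big /=; apply: eq_bigr => -[w u] _ /=.
by case: (A _); rewrite ?mulr1 ?mulr0.
Qed.

Lemma Pr_omega_message (A : pred (messages (msize c))) :
  Pr omega_law (fun o => A o.1) =
  #|[set w | A w]%SET|%:R / #|messages (msize c)|%:R.
Proof.
rewrite Pr_omega mulrC; congr (_ / _).
transitivity (\sum_w (A w)%:R : R).
  apply: eq_bigr => w _ /=; rewrite -mulr_suml.
  by rewrite (proj2 (prod_pmf_is_pmf noise_coord_law_pmf)) mul1r.
rewrite -sum1_card natr_sum [RHS]big_mkcond /=; apply: eq_bigr => w _.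
by rewrite inE; case: (A w).
Qed.

Lemma omega_law_pmf : is_pmf omega_law.
Proof.
split=> [om|].
  by rewrite mulr_ge0 ?invr_ge0 ?(prod_pmf_ge0 noise_coord_law_pmf).
have := Pr_omega_message predT; rewrite /Pr => ->.
rewrite (_ : [set w | predT w]%SET = [set: messages (msize c)]%SET);
  last by apply/setP => w; rewrite !inE.
by rewrite cardsT divff // pnatr_eq0 -lt0n (messages_gt0 (msize_gt0 c)).
Qed.

Lemma omega_uniform i (v : 'I_(msize c i)) :
  Pr omega_law (fun o => o.1 i == v) = (msize c i)%:R^-1.
Proof.
rewrite (Pr_omega_message (fun w : messages _ => w i == v)).
rewrite -(card_message_eq v) natrM invfM mulrA divff ?mul1r //.
have : (0 < #|[set w : messages (msize c) | w i == v]%SET| * msize c i)%N.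
  by rewrite card_message_eq (messages_gt0 (msize_gt0 c)).
by rewrite muln_gt0 lt0n pnatr_eq0 => /andP[].
Qed.

Lemma omega_indep (w : forall i : 'I_N, 'I_(msize c i)) :
  Pr omega_law (fun o => [forall i, o.1 i == w i]) =
  \prod_i Pr omega_law (fun o => o.1 i == w i).
Proof.
under [RHS]eq_bigr => i _ do rewrite omega_uniform.
rewrite (Pr_omega_message (fun v : messages _ => [forall i, v i == w i])).
pose w0 : messages (msize c) := [ffun i => w i].
rewrite (_ : finset _ = [set w0]%SET).
  by rewrite cards1 div1r card_messages natr_prod prodfV.
apply/setP => v; rewrite !inE; apply/forallP/eqP => [vw|-> i].
  by apply/ffunP => i; rewrite ffunE; apply/eqP.
by rewrite ffunE.
Qed.

(** [A] ignores the noise entry of [x] at time [k] but forces [x] to be sent, so the output reads an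
    entry independent of [A]. *)
Lemma out_seq_noise_indep (e : edge N) (k : 'I_n) (x : inp net e)
    (y : out net e) w (A : pred noise) :
  (forall u v, A (mix [set noise_coord k x]%SET v u) = A u) ->
  (forall u, A u -> in_seq w u e k = x) ->
  \sum_u mu u * (A u && (out_seq w u e k == y))%:R =
  (\sum_u mu u * (A u)%:R) * chan net e x y.
Proof.
move=> A_mix A_in.
transitivity (\sum_u mu u *
    (A u && (of_letter e (u (noise_coord k x)) == y))%:R).
  apply: eq_bigr => u _; congr (_ * _); case: (boolP (A u)) => //= /A_in in_u.
  by rewrite out_seqE in_u.
rewrite (resample noise_coord_law_pmf [set noise_coord k x]%SET) mulr_suml.
apply: eq_bigr => u _; rewrite -mulrA; congr (_ * _).
under eq_bigr => v _ do rewrite A_mix mix_in ?inE //.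
case: (A u) => /=; last by rewrite mul0r big1 // => v _; rewrite mulr0.
rewrite mul1r.
rewrite (prod_pmf_expect1 noise_coord_law_pmf _
  (fun z => (of_letter e z == y)%:R)) -(noise_law_of_letter x) [RHS]big_mkcond.
by apply: eq_bigr => z _; rewrite mulr_natr mulrb.
Qed.

End Realize.

Section Realization.
Variables (R : realType) (N : nat) (net : network R N) (V : {set 'I_N}).
Variables (n : nat) (c : net_code net V all_one n) (pi : 'S_(N ^ 2)).
Notation mu := (prod_pmf (@noise_coord_law R N net n)).

(** The past and the inputs at time [k] use noise of earlier times, and the outputs already produced
    at time [k] read entries of other edges. So none of them looks at the entry that [e] reads, and
    [out_seq_noise_indep] applies for any [pi]. *)
Lemma omega_memoryless (k : 'I_n) (h : 'I_(N ^ 2))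
    (w : forall i : 'I_N, 'I_(msize c i))
    (x : forall e : edge N, 'I_n -> inp net e)
    (y : forall e : edge N, 'I_n -> out net e) :
  let past (o : omega c) :=
    [forall i, o.1 i == w i] &&
    [forall e, [forall s : 'I_n, (s < k)%N ==>
       ((in_seq o.1 o.2 e s == x e s) && (out_seq o.1 o.2 e s == y e s))]] in
  let X_on (S : {set edge N}) (o : omega c) :=
    [forall (e | e \in S), in_seq o.1 o.2 e k == x e k] in
  let Y_on (S : {set edge N}) (o : omega c) :=
    [forall (e | e \in S), out_seq o.1 o.2 e k == y e k] in
  forall e : edge N, e \in Omega (pi h) ->
  Pr (@omega_law R N net V n c) (fun o => [&& past o, X_on (Omega_upto pi h.+1) o
                      & Y_on (Omega_upto pi h.+1) o]) =
  Pr (@omega_law R N net V n c) (fun o => [&& past o, X_on (Omega_upto pi h.+1) o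
                      & Y_on (Omega_upto pi h) o]) *
  chan net e (x e k) (y e k).
Proof.
move=> past X_on Y_on e; rewrite position_Omega => /eqP eh.
rewrite !Pr_omega -mulrA; congr (_ * _); rewrite mulr_suml.
apply: eq_bigr => v _.
pose A (u : noise net n) := [&& past (v, u), X_on (Omega_upto pi h.+1) (v, u)
                      & Y_on (Omega_upto pi h) (v, u)].
rewrite -(@out_seq_noise_indep _ _ _ _ _ c e k (x e k) (y e k) v A).
- apply: eq_bigr => u _; congr (_ * (nat_of_bool _)%:R).
  by rewrite /A /Y_on -eh forall_Omega_uptoS -!andbA.
- move=> u v'; rewrite /A.
  set u' := mix _ _ _.
  have uu' (s : 'I_n) a : (s < k)%N -> u' (s, a) = u (s, a).
    move=> sk; rewrite mix_notin // inE; apply: contraTneq sk => -[-> _].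
    by rewrite ltnn.
  congr [&& _ && _, _ & _].
  + apply: eq_forallb => e'; apply: eq_forallb => s.
    case: ltnP => //= sk.
    by rewrite (in_seq_ext _ uu' _ (ltnW sk)) (out_seq_ext _ uu' _ sk).
  + by apply: eq_forallb => e'; rewrite /= (in_seq_ext _ uu' _ (leqnn k)).
  + apply: eq_forallb => e' /=; rewrite position_Omega_upto.
    case: ltnP => //= e'h; rewrite !out_seqE (in_seq_ext _ uu' _ (leqnn k)).
    rewrite /u' mix_notin // inE /noise_coord; apply/eqP => -[ee' _].
    by rewrite -eh ee' ltnn in e'h.
- move=> u /and3P[_ /forallP/(_ e)].
  by rewrite position_Omega_upto eh ltnSn => /eqP.
Qed.

Definition omega_realization : realization pi c :=
  @Realization R N net V pi all_one n c (omega c) (@omega_law R N net V n c)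
    (fun i o => o.1 i) (fun e k o => in_seq o.1 o.2 e k)
    (fun e k o => out_seq o.1 o.2 e k)
    (@omega_law_pmf _ _ _ _ _ _) (@omega_uniform _ _ _ _ _ _)
    (@omega_indep _ _ _ _ _ _)
    (fun i j k o => erefl) omega_memoryless.

Lemma error_prob_omega (D : {set 'I_N}) : error_prob D omega_realization =
  #|messages (msize c)|%:R^-1 * \sum_(w : messages (msize c)) \sum_u mu u *
   ([exists (i | i \in V), exists (j | j \in D),
       dec i (w j) (fun l => [tuple out_seq w u (l, j) s | s < n]) != w i])%:R.
Proof. by rewrite /error_prob Pr_omega. Qed.

End Realization.

(** * Mutual information and capacity *)

Section Information.
Variable R : realType.

Lemma ln_le_subr1 (x : R) : 0 < x -> ln x <= x - 1.
Proof. by move=> x0; rewrite -{1}(subrK 1 x) addrC le_ln1Dx // ltrBrDr addNr. Qed.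

Lemma ln2_gt0 : 0 < ln 2 :> R.
Proof. by rewrite ln_gt0 // ltr1n. Qed.

Variables (N : nat) (net : network R N) (e : edge N).
Implicit Type p : inp net e -> R.

Definition out_law p (y : out net e) : R := \sum_x p x * chan net e x y.

Definition information p : R :=
  \sum_x \sum_y p x * chan net e x y * log2 (chan net e x y / out_law p y).

Lemma out_law_ge p x y : is_pmf p -> p x * chan net e x y <= out_law p y.
Proof.
move=> [p0 _]; rewrite /out_law (bigD1 x) //= lerDl sumr_ge0 // => x' _.
by rewrite mulr_ge0 //; case: (chan_pmf x').
Qed.

Lemma out_law_pmf p : is_pmf p -> is_pmf (out_law p).
Proof.
move=> [p0 p1]; split=> [y|].
  by apply: sumr_ge0 => x _; rewrite mulr_ge0 //; case: (chan_pmf x).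
rewrite exchange_big /= -[RHS]p1; apply: eq_bigr => x _.
by rewrite -mulr_sumr (proj2 (chan_pmf x)) mulr1.
Qed.

Lemma mutual_info_channel p :
  mutual_info (fun xy : inp net e * out net e => p xy.1 * chan net e xy.1 xy.2)
  = information p.
Proof.
rewrite /mutual_info /information; apply: eq_bigr => x _; apply: eq_bigr => y _ /=.
have [->|p0] := eqVneq (p x) 0; first by rewrite !mul0r.
congr (_ * log2 _); rewrite -mulr_sumr (proj2 (chan_pmf x)) mulr1.
by rewrite invfM mulrACA divff // mul1r.
Qed.

(** A crude bound that makes the supremum in [capacity] finite. By [out_law_ge] the quotient in the
    logarithm is at most [1 / p x]; as [ln z <= z], each term is at most [chan net e x y / ln 2]. *)
Lemma information_ub p : is_pmf p ->
  information p <= (#|inp net e| * #|out net e|)%N%:R / ln 2.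
Proof.
move=> pp; have [p0 p1] := pp.
have -> : (#|inp net e| * #|out net e|)%N%:R / ln 2 =
    \sum_(x : inp net e) \sum_(y : out net e) (ln 2)^-1 :> R.
  by rewrite !sumr_const -mulrnA mulr_natl mulnC.
apply: ler_sum => x _; apply: ler_sum => y _.
have [c0 c1] := chan_pmf x.
rewrite /log2 mulrA -[leRHS]mul1r ler_pM2r ?invr_gt0 ?ln2_gt0 //.
have [pc0|pc_neq0] := eqVneq (p x * chan net e x y) 0.
  by rewrite pc0 mul0r ler01.
have pc_gt0 : 0 < p x * chan net e x y by rewrite lt0r pc_neq0 mulr_ge0.
have px : 0 < p x.
  by rewrite lt0r p0 andbT; apply: contraNneq pc_neq0 => ->; rewrite mul0r.
have cx : 0 < chan net e x y.
  by rewrite lt0r c0 andbT; apply: contraNneq pc_neq0 => ->; rewrite mulr0.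
have q_gt0 : 0 < out_law p y by apply: lt_le_trans (out_law_ge x y pp).
have c_le1 : chan net e x y <= 1.
  by rewrite -[leRHS]c1 (bigD1 y) //= lerDl sumr_ge0.
apply: (@le_trans _ _ (p x * chan net e x y * (p x)^-1)).
  rewrite ler_pM2l // (le_trans (ln_le_subr1 _)) ?divr_gt0 // lerBlDr.
  apply: (@le_trans _ _ (p x)^-1); last by rewrite lerDl.
  by rewrite ler_pdivrMr // mulrC ler_pdivlMr // mulrC out_law_ge.
by rewrite mulrAC divff ?mul1r // gt_eqF.
Qed.

Lemma capacity_has_sup :
  has_sup [set mutual_info (fun xy : inp net e * out net e =>
                          p xy.1 * chan net e xy.1 xy.2)
      | p in [set p : inp net e -> R | is_pmf p]]%classic.
Proof.
split; last first.
  exists ((#|inp net e| * #|out net e|)%N%:R / ln 2) => _ [p pp <-].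
  by rewrite mutual_info_channel information_ub.
pose p (x : inp net e) : R := (x == inp0 net e)%:R.
exists (information p), p; last exact: mutual_info_channel.
split=> [x|]; first exact: ler0n.
by rewrite (bigD1 (inp0 net e)) //= /p eqxx big1 ?addr0 // => x /negPf ->.
Qed.

Lemma information_le_capacity p : is_pmf p -> information p <= capacity net e.
Proof.
move=> pp; rewrite -mutual_info_channel.
by apply: ub_le_sup; [case: capacity_has_sup|exists p].
Qed.

Lemma capacity_approx (delta : R) : 0 < delta ->
  exists2 p, is_pmf p & capacity net e - delta < information p.
Proof.
move=> d0; have [_ [p pp <-]] := sup_adherent d0 capacity_has_sup.
by rewrite mutual_info_channel => lt_p; exists p.
Qed.

End Information.

(** * Converse *)

Section Converse.
Variables (R : realType) (N : nat) (net : network R N) (V : {set 'I_N}).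
Variables (pi : 'S_(N ^ 2)) (B : delay_profile N) (n : nat).
Variables (c : net_code net V B n) (r : realization pi c).
Hypothesis pi_B : feasible pi B.

Let Om := sample_space r.
Let P : Om -> R := prob (r := r).
Let W (i : 'I_N) (o : Om) : 'I_(msize c i) := Wv i o.
Let X (e : edge N) (k : 'I_n) (o : Om) : inp net e := Xv e k o.
Let Y (e : edge N) (k : 'I_n) (o : Om) : out net e := Yv e k o.

Let P_ge0 o : 0 <= P o. Proof. exact: (proj1 (prob_pmf r)). Qed.
Let P_sum1 : \sum_o P o = 1. Proof. exact: (proj2 (prob_pmf r)). Qed.

(** A single clock for all channel uses: by time, then by position in [pi]. *)
Definition stage (e : edge N) (k : 'I_n) : nat := (k * N ^ 2 + position pi e)%N.

Lemma stage_lt e k e' k' : (stage e k < stage e' k')%N =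
  (k < k')%N || (k == k') && (position pi e < position pi e')%N.
Proof.
have := ltn_ord (position pi e); have := ltn_ord (position pi e').
rewrite /stage -(inj_eq val_inj) /=; case: ltngtP => /=; nia.
Qed.

Lemma stage_inj e k e' k' : stage e k = stage e' k' -> e = e' /\ k = k'.
Proof.
move=> eq_st; have := stage_lt e k e' k'; have := stage_lt e' k' e k.
rewrite eq_st ltnn; case: (ltngtP k k') => //= /val_inj ->.
rewrite !eqxx /=; case: (ltngtP (position pi e) (position pi e')) => //= eq_pos.
by move=> _ _; split=> //; apply: (@position_inj _ pi); apply: val_inj.
Qed.

Lemma stage_max e k : (stage e k < n * N ^ 2)%N.
Proof.
apply: leq_trans (leq_mul (ltn_ord k) (leqnn _)).
by rewrite /stage mulSn addnC ltn_add2r.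
Qed.

Definition same_history e (k : 'I_n) (o1 o2 : Om) : Prop :=
  [/\ forall i, W i o1 = W i o2, X e k o1 = X e k o2 &
      forall e' s, (stage e' s < stage e k)%N ->
        X e' s o1 = X e' s o2 /\ Y e' s o1 = Y e' s o2].

(** The literal event of [memoryless] at edge [e] and time [k]; [history_testP] translates it into
    the order of stages. *)
Definition history_test e (k : 'I_n)
    (w : forall i : 'I_N, 'I_(msize c i))
    (x : forall e : edge N, 'I_n -> inp net e)
    (y : forall e : edge N, 'I_n -> out net e) (o : Om) : bool :=
  [&& [forall i, W i o == w i] && [forall e, [forall s : 'I_n, (s < k)%N ==>
         ((X e s o == x e s) && (Y e s o == y e s))]],
     [forall (e' | e' \in Omega_upto pi (position pi e).+1), X e' k o == x e' k]
   & [forall (e' | e' \in Omega_upto pi (position pi e)), Y e' k o == y e' k]].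

Lemma history_testP e (k : 'I_n) w x y o :
  reflect ([/\ forall i, W i o = w i, X e k o = x e k &
      forall e' s, (stage e' s < stage e k)%N ->
        X e' s o = x e' s /\ Y e' s o = y e' s])
    (history_test e k w x y o).
Proof.
apply: (iffP and3P) => [[/andP[/forallP wP /forallP pP] /forallP xP /forallP yP]|].
  split=> [i||e' s]; first exact/eqP.
    by apply/eqP; have := xP e; rewrite position_Omega_upto ltnSn.
  rewrite stage_lt => /orP[sk|/andP[/eqP -> e'e]].
    by have /forallP/(_ s) := pP e'; rewrite sk => /andP[/eqP -> /eqP ->].
  have := xP e'; have := yP e'; rewrite !position_Omega_upto e'e ltnS ltnW //=.
  by move=> /eqP -> /eqP ->.
move=> [wP xP hP]; split.
- apply/andP; split; first by apply/forallP => i; rewrite wP.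
  apply/forallP => e'; apply/forallP => s; apply/implyP => sk.
  by have [|-> ->] := hP e' s; rewrite ?eqxx // stage_lt sk.
- apply/forallP => e'; apply/implyP; rewrite position_Omega_upto ltnS leq_eqVlt.
  move=> /orP[/eqP/val_inj/position_inj ->|e'e]; first exact/eqP.
  by have [|-> _] := hP e' k; rewrite ?eqxx // stage_lt eqxx e'e orbT.
- apply/forallP => e'; apply/implyP; rewrite position_Omega_upto => e'e.
  by have [|_ ->] := hP e' k; rewrite ?eqxx // stage_lt eqxx e'e orbT.
Qed.

Definition update (y : forall e, 'I_n -> out net e) e (k : 'I_n) (v : out net e) :
    forall e, 'I_n -> out net e :=
  dfwith y e (fun s => if s == k then v else y e s).

Arguments update : clear implicits.

Lemma update_same y e k v : update y e k v e k = v.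
Proof. by rewrite /update dfwithin eqxx. Qed.

Lemma update_neq y e (k : 'I_n) v e' (s : 'I_n) : stage e' s != stage e k ->
  update y e k v e' s = y e' s.
Proof.
move=> ne; rewrite /update; have [ee'|ne_e] := eqVneq e e'.
  subst e'; rewrite dfwithin; case: eqP => // sk.
  by rewrite sk eqxx in ne.
by rewrite dfwithout.
Qed.

Lemma update_id y e k : update y e k (y e k) = y.
Proof.
apply: functional_extensionality_dep => e'.
apply: functional_extensionality_dep => s.
have [st|ne] := eqVneq (stage e' s) (stage e k); last by rewrite update_neq.
by have [-> ->] := stage_inj st; rewrite update_same.
Qed.

(** This is [memoryless] at the values recorded by [o], with the current output overwritten by [v].
    The history does not test that output, so overwriting leaves [H] unchanged. *)
Lemma history_atom e (k : 'I_n) (o : Om) (v : out net e) :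
  let H := history_test e k (W^~ o) (fun e s => X e s o) (fun e s => Y e s o) in
  Pr P (fun o' => H o' && (Y e k o' == v)) = Pr P H * chan net e (X e k o) v.
Proof.
move=> H; pose y := update (fun e s => Y e s o) e k v.
have := @memoryless _ _ _ _ _ _ _ _ r k (position pi e) (W^~ o)
  (fun e s => X e s o) y e.
rewrite position_Omega eqxx /y update_same -/y => /(_ erefl) step.
have testE : history_test e k (W^~ o) (fun e s => X e s o) y =1 H.
  move=> o'; apply/history_testP/history_testP => -[h1 h2 h];
    split=> // e' s lt_st; have [-> ->] := h e' s lt_st;
    by rewrite /y update_neq // neq_ltn lt_st.
transitivity (Pr P (history_test e k (W^~ o) (fun e s => X e s o) y) *
  chan net e (X e k o) v); last by congr (_ * _); apply: eq_bigl.
apply: etrans step; apply: eq_bigl => o'.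
rewrite -testE /history_test -!andbA; do 3!congr (_ && _).
by rewrite [RHS]forall_Omega_uptoS /y update_same.
Qed.

(** The tower rule for one channel use: on each class of equal history, [G] and the input are
    constant and the output follows the channel. *)
Lemma one_step e (k : 'I_n) (G : Om -> out net e -> R) :
  (forall o1 o2 v, same_history e k o1 o2 -> G o1 v = G o2 v) ->
  \sum_o P o * G o (Y e k o) =
  \sum_o P o * \sum_v chan net e (X e k o) v * G o v.
Proof.
move=> G_hist.
pose H o := history_test e k (W^~ o) (fun e s => X e s o) (fun e s => Y e s o).
have HP o1 o2 : reflect (same_history e k o2 o1) (H o1 o2).
  apply: (iffP (history_testP _ _ _ _ _ _)) => -[a1 a2 a3]; split=> //.
have Hsym o1 o2 : H o1 o2 -> H o2 o1.
  move=> /HP[a1 a2 a3]; apply/HP; split=> // e' s /a3[-> ->] //.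
have Htrans o1 o2 o3 : H o1 o2 -> H o2 o3 -> H o1 o3.
  move=> /HP[a1 a2 a3] /HP[b1 b2 b3]; apply/HP; split=> [i||e' s lt_st].
  - by rewrite b1.
  - by rewrite b2.
  - by have [-> ->] := b3 _ _ lt_st; apply: a3.
have Hrefl o : H o o by apply/HP.
(* [choose] fixes one representative per history class, so the classes are the fibres of [rep]. *)
pose rep o := choose (H o) o.
have Hrep o : H o (rep o) by apply: chooseP.
have rep_eq o1 o2 : H o1 o2 -> rep o1 = rep o2.
  move=> H12; rewrite /rep (choose_id (x0 := o1) (y0 := o2)) //.
  apply: eq_choose => o3; apply/idP/idP => h.
    by apply: Htrans h; apply: Hsym.
  exact: Htrans H12 h.
rewrite (partition_big rep xpredT) //= [RHS](partition_big rep xpredT) //=.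
apply: eq_bigr => o1 _.
have [[q0 <-]|no] := pselect (exists q0, rep q0 = o1); last first.
  by rewrite !big_pred0 // => o; apply/eqP => oo1; apply: no; exists o.
set o2 := rep q0.
have classE o : (rep o == o2) = H o2 o.
  apply/eqP/idP => [<-|/rep_eq <-]; first exact/Hsym/Hrep.
  by rewrite /o2 -(rep_eq _ _ (Hrep q0)).
rewrite (eq_bigl _ _ classE) [RHS](eq_bigl _ _ classE).
transitivity (Pr P (H o2) * \sum_v chan net e (X e k o2) v * G o2 v); last first.
  rewrite mulr_suml; apply: eq_bigr => o /HP Ho; congr (_ * _).
  apply: eq_bigr => v _; rewrite (G_hist _ _ _ Ho).
  by have [_ -> _] := Ho.
rewrite (partition_big (Y e k) xpredT) //= mulr_sumr; apply: eq_bigr => v _.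
rewrite mulrA -history_atom mulr_suml; apply: eq_bigr => o /andP[/HP Ho /eqP ->].
by rewrite (G_hist _ _ _ Ho).
Qed.

(** * Change of measure across a cut *)

Variable T : {set 'I_N}.

Definition out_marginal e k (v : out net e) : R := Pr P (fun o => Y e k o == v).

Lemma out_marginal_pmf e k : is_pmf (@out_marginal e k).
Proof.
split=> [v|]; first exact: sumr_ge0.
rewrite -P_sum1 [RHS](partition_big (Y e k) xpredT) //.
Qed.

(** Division by 0 yields 0 here; by [ratio_gt0] this does not happen at sample points of positive
    probability. *)
Definition ratio e k o : R :=
  out_marginal k (Y e k o) / chan net e (X e k o) (Y e k o).

Lemma ratio_ge0 e k o : 0 <= ratio e k o.
Proof.
by rewrite divr_ge0 //; [case: (@out_marginal_pmf e k)|case: (chan_pmf (X e k o))].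
Qed.

Definition cut_edge : pred (edge N) := fun e => (e.1 \in T) && (e.2 \notin T).

(* The likelihood ratio between the law under which every edge from [T] to its
   complement emits its output marginal independently of everything else and
   the true law, restricted to the outputs produced before stage [t]. *)
Definition weight (t : nat) o : R :=
  \prod_(ek : edge N * 'I_n | cut_edge ek.1 && (stage ek.1 ek.2 < t)%N)
    ratio ek.1 ek.2 o.

Lemma weight_ge0 t o : 0 <= weight t o.
Proof. by apply: prodr_ge0 => ek _; apply: ratio_ge0. Qed.

Lemma weightS e k o : weight (stage e k).+1 o =
  weight (stage e k) o * (if cut_edge e then ratio e k o else 1).
Proof.
rewrite {1}/weight; case: ifP => ce; last first.
  rewrite mulr1; apply: eq_bigl => -[e' k'] /=; rewrite ltnS leq_eqVlt.
  by case: eqP => [/stage_inj[-> _]|//]; rewrite ce.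
rewrite (bigD1 (e, k)) /= ?ce ?ltnSn // mulrC; congr (_ * _).
apply: eq_bigl => -[e' k'] /=; rewrite ltnS leq_eqVlt.
case: (stage e' k' =P stage e k) => [st|ne].
  by have [-> ->] := stage_inj st; rewrite ltnn eqxx /= !andbF.
rewrite /=; case: eqP => [[ee kk]|_]; last by rewrite andbT.
by case: ne; rewrite ee kk.
Qed.

Lemma weight_none t o : (forall e k, stage e k != t) -> weight t.+1 o = weight t o.
Proof.
move=> none; apply: eq_bigl => -[e k] /=.
by rewrite ltnS leq_eqVlt (negPf (none e k)).
Qed.

Notation outputs := (forall e : edge N, 'I_n -> out net e).

Definition local_at_sinks (f : outputs -> R) : Prop := forall y y' : outputs,
  (forall e k, e.2 \notin T -> y e k = y' e k) -> f y = f y'.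

(** The comparison law on an edge ending outside [T]. If the edge also starts outside [T], its input
    is computed from a message and outputs available outside [T], so the messages of [T] never
    enter. *)
Definition kernel (w : messages (msize c)) (y : outputs) e k (v : out net e) : R :=
  if e.1 \in T then out_marginal k v else chan net e (code_input w y e k) v.

Lemma kernel_pmf w y e k : is_pmf (@kernel w y e k).
Proof.
rewrite /kernel; case: (e.1 \in T); first exact: out_marginal_pmf.
exact: chan_pmf.
Qed.

Definition at_stage (t : nat) : option (edge N * 'I_n) :=
  [pick ek : edge N * 'I_n | stage ek.1 ek.2 == t].

Notation horizon := (n * N ^ 2)%N.

(* The conditional expectation of [f] given the outputs of the first
   [horizon - d] stages, under the law whose density is [weight]. *)
Fixpoint value (f : outputs -> R) (w : messages (msize c)) (d : nat)
    (y : outputs) : R :=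
  if d is d'.+1 then
    if at_stage (horizon - d) is Some ek then
      if ek.1.2 \in T then value f w d' y
      else \sum_v kernel w y ek.2 v * value f w d' (update y ek.1 ek.2 v)
    else value f w d' y
  else f y.

Lemma value_ge0 f w d y : (forall y, 0 <= f y) -> 0 <= value f w d y.
Proof.
move=> f0; elim: d y => [|d IH] y //=.
case: (at_stage _) => // ek; case: ifP => // _; apply: sumr_ge0 => v _.
by rewrite mulr_ge0 //; case: (@kernel_pmf w y ek.1 ek.2).
Qed.

(** Feasibility is used here: an output seen without delay was produced at an earlier stage of the
    same time, so earlier stages settle the input. *)
Lemma kernel_ext w y y' e k : e.2 \notin T ->
  (forall e' s, e'.2 \notin T -> (stage e' s < stage e k)%N -> y e' s = y' e' s) ->
  @kernel w y e k =1 @kernel w y' e k.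
Proof.
case: e => i j jT yy' v; rewrite /kernel; case: ifPn => //= iT.
congr (chan _ _ _ _); apply: code_input_ext => // l s lt_s.
apply: yy' => //; rewrite stage_lt.
case Bl: (B l i j) lt_s; first by rewrite subn1 => ->.
rewrite subn0 ltnS leq_eqVlt => /orP[/eqP/val_inj -> |-> //].
by rewrite eqxx (pi_B Bl) orbT.
Qed.

Lemma value_ext f w d y y' : local_at_sinks f -> (d <= horizon)%N ->
  (forall e k, e.2 \notin T -> (stage e k < horizon - d)%N -> y e k = y' e k) ->
  value f w d y = value f w d y'.
Proof.
move=> f_loc; elim: d y y' => [|d IH] y y' le_d yy' /=.
  by apply: f_loc => e k eT; apply: yy' => //; rewrite subn0 stage_max.
have Sd : (horizon - d = (horizon - d.+1).+1)%N by rewrite -subSn.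
rewrite /at_stage; case: pickP => [[e k] /= /eqP st|none]; last first.
  apply: IH => [|e k eT]; first exact: ltnW.
  by rewrite Sd ltnS leq_eqVlt (none (e, k)) => /yy' ->.
case: ifPn => eT.
  apply: IH => [|e' k' e'T]; first exact: ltnW.
  rewrite Sd ltnS leq_eqVlt -st => /orP[/eqP/stage_inj[ee' _]|]; last first.
    by rewrite st; apply: yy'.
  by rewrite ee' eT in e'T.
apply: eq_bigr => v _; congr (_ * _).
  by apply: kernel_ext => // e' s e'T; rewrite st; apply: yy'.
apply: IH => [|e' k' e'T]; first exact: ltnW.
rewrite Sd ltnS leq_eqVlt -st => /predU1P[/stage_inj[ee kk]|lt_st].
  by subst e' k'; rewrite !update_same.
by rewrite !update_neq ?neq_ltn ?lt_st //; apply: yy'; rewrite -?st.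
Qed.

Definition messages_of o : messages (msize c) := [ffun i => W i o].
Definition outputs_of o : outputs := fun e k => Y e k o.

Lemma input_of o e k : X e k o = code_input (messages_of o) (outputs_of o) e k.
Proof.
case: e => i j; rewrite /X encoding /code_input /messages_of /outputs_of.
by rewrite ffunE.
Qed.

Lemma same_history_weight e k o1 o2 : same_history e k o1 o2 ->
  weight (stage e k) o1 = weight (stage e k) o2.
Proof.
move=> [_ _ hist]; apply: eq_bigr => -[e' s] /= /andP[_ /hist[eX eY]].
by rewrite /ratio eX eY.
Qed.

Lemma same_history_messages e k o1 o2 : same_history e k o1 o2 ->
  messages_of o1 = messages_of o2.
Proof. by move=> [hW _ _]; apply/ffunP => i; rewrite !ffunE; apply: hW. Qed.

(** Averaging over the current output by [one_step] turns channel law times [ratio] into the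
    marginal. Only an inequality holds, because the comparison law may charge outputs that the
    channel cannot produce. *)
Lemma value_step f w d : local_at_sinks f -> (forall y, 0 <= f y) ->
  (d < horizon)%N ->
  \sum_o P o * (weight (horizon - d) o * (messages_of o == w)%:R *
               value f w d (outputs_of o)) <=
  \sum_o P o * (weight (horizon - d.+1) o * (messages_of o == w)%:R *
               value f w d.+1 (outputs_of o)).
Proof.
move=> f_loc f0 lt_d.
have Sd : (horizon - d = (horizon - d.+1).+1)%N by rewrite -subSn.
rewrite Sd /= /at_stage; case: pickP => [[e k] /= /eqP st|none]; last first.
  rewrite le_eqVlt; apply/orP; left; apply/eqP; apply: eq_bigr => o _.
  by rewrite weight_none // => e k; rewrite (none (e, k)).
rewrite -st; under eq_bigr => o _ do rewrite weightS /cut_edge.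
case: (boolP (e.2 \in T)) => eT.
  by under eq_bigr => o _ do rewrite andbF mulr1.
under eq_bigr => o _ do rewrite andbT.
pose U o v := value f w d (update (outputs_of o) e k v).
have U_hist o1 o2 v : same_history e k o1 o2 -> U o1 v = U o2 v.
  move=> [_ _ hist]; apply: value_ext => //; first exact: ltnW.
  move=> e' s e'T; rewrite Sd ltnS leq_eqVlt -st => /predU1P[/stage_inj[ee ss]|lt_st].
    by subst e' s; rewrite !update_same.
  by rewrite !update_neq ?neq_ltn ?lt_st // /outputs_of; have [] := hist _ _ lt_st.
have UY o : value f w d (outputs_of o) = U o (Y e k o).
  by rewrite /U update_id.
have U0 o v : 0 <= U o v by apply: value_ge0.
pose G o v := weight (stage e k) o * (messages_of o == w)%:R * U o v *
  (if e.1 \in T then out_marginal k v / chan net e (X e k o) v else 1).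
have G_hist o1 o2 v : same_history e k o1 o2 -> G o1 v = G o2 v.
  move=> h; rewrite /G (same_history_weight h) (same_history_messages h).
  by rewrite (U_hist _ _ _ h); have [_ -> _] := h.
apply: (@le_trans _ _ (\sum_o P o * G o (Y e k o))).
  rewrite le_eqVlt; apply/orP; left; apply/eqP; apply: eq_bigr => o _.
  rewrite UY /G /ratio; set b := (if _ then _ else _).
  by rewrite -!mulrA; do 2!congr (_ * _); rewrite mulrC -mulrA.
rewrite (one_step G_hist); apply: ler_sum => o _; apply: ler_wpM2l => //.
rewrite mulr_sumr; apply: ler_sum => v _.
have c0 : 0 <= chan net e (X e k o) v by case: (chan_pmf (X e k o)).
rewrite /G -/(U o v) /kernel; case: (messages_of o =P w) => [mw|_]; last first.
  by rewrite !(mulr0, mul0r).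
rewrite !mulr1 mulrCA -mulrA; apply: ler_wpM2l; first exact: weight_ge0.
rewrite mulrC; apply: ler_wpM2r => //.
case: ifPn => eT1; last by rewrite mulr1 input_of mw.
have [->|cn0] := eqVneq (chan net e (X e k o) v) 0.
  by rewrite mul0r; case: (@out_marginal_pmf e k).
by rewrite mulrCA divff ?mulr1.
Qed.

(** Iterates [value_step] back to the first stage. There the weight is an empty product and [value]
    does not depend on the outputs, so only the probability of [w] remains. *)
Lemma weight_le_value f w y : local_at_sinks f -> (forall y, 0 <= f y) ->
  \sum_o P o * (weight horizon o * (messages_of o == w)%:R * f (outputs_of o)) <=
  (#|messages (msize c)|%:R)^-1 * value f w horizon y.
Proof.
move=> f_loc f0.
have W_law : \sum_o P o * (messages_of o == w)%:R = #|messages (msize c)|%:R^-1.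
  transitivity (Pr P (fun o => [forall i, W i o == w i])).
    rewrite /Pr [RHS]big_mkcond /=; apply: eq_bigr => o _.
    rewrite (_ : (messages_of o == w) = [forall i, W i o == w i]).
      by rewrite mulr_natr mulrb.
    apply/eqP/forallP => [<- i|h]; first by rewrite ffunE.
    by apply/ffunP => i; rewrite ffunE; apply/eqP/h.
  have := @message_indep _ _ _ _ _ _ _ _ r w => ->.
  under eq_bigr => i _ do rewrite message_uniform.
  by rewrite prodfV card_messages natr_prod.
rewrite -W_law mulr_suml.
have : (horizon <= horizon)%N by [].
suff claim d : (d <= horizon)%N ->
    \sum_o P o * (weight horizon o * (messages_of o == w)%:R * f (outputs_of o))
    <= \sum_o P o * (weight (horizon - d) o * (messages_of o == w)%:R *
          value f w d (outputs_of o)).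
  move=> /claim le1; apply: le_trans le1 _; rewrite le_eqVlt; apply/orP; left.
  apply/eqP; apply: eq_bigr => o _; rewrite subnn -[RHS]mulrA; congr (_ * _).
  rewrite [weight _ _]big_pred0 ?mul1r; last by move=> ek; rewrite andbF.
  congr (_ * _); apply: value_ext => // e k _; by rewrite subnn.
elim: d => [_|d IH lt_d]; first by rewrite subn0.
by apply: le_trans (IH (ltnW lt_d)) _; apply: value_step.
Qed.

(** Tuples of [S] agree outside [T] and so share every kernel used by [value]; the sum over [S]
    moves inside the recursion. In effect, the outputs received outside [T] carry no information on
    the messages of [T]. *)
Lemma value_sum_le1 (S : {set messages (msize c)}) (w0 : messages (msize c))
    (f : messages (msize c) -> outputs -> R) d y :
  (forall w i, w \in S -> i \notin T -> w i = w0 i) ->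
  (forall y, \sum_(w in S) f w y <= 1) ->
  \sum_(w in S) value (f w) w d y <= 1.
Proof.
move=> Sw0 f1; elim: d y => [|d IH] y //=.
case: (at_stage _) => // ek; case: (boolP (ek.1.2 \in T)) => // eT.
rewrite exchange_big /=.
rewrite -[leRHS](proj2 (@kernel_pmf w0 y ek.1 ek.2)); apply: ler_sum => v _.
rewrite -[leRHS]mulr1.
rewrite (eq_bigr (fun w => @kernel w0 y ek.1 ek.2 v *
   value (f w) w d (update y ek.1 ek.2 v))).
  by rewrite -mulr_sumr ler_wpM2l //; case: (@kernel_pmf w0 y ek.1 ek.2).
move=> w wS; congr (_ * _); rewrite /kernel; case: ifPn => // iT.
congr (chan _ _ _ _); case: ek.1 iT {eT v} => i j /= iT.
by apply: (@code_input_ext _ _ _ _ _ _ c) => //; apply: Sw0.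
Qed.

Definition in_marginal e k (a : inp net e) : R := Pr P (fun o => X e k o == a).

Lemma expectation_input e k (h : inp net e -> R) :
  \sum_o P o * h (X e k o) = \sum_a in_marginal k a * h a.
Proof.
rewrite (partition_big (X e k) xpredT) //=; apply: eq_bigr => a _.
by rewrite /in_marginal /Pr mulr_suml; apply: eq_bigr => o /eqP ->.
Qed.

Lemma in_marginal_pmf e k : is_pmf (@in_marginal e k).
Proof.
split=> [a|]; first exact: sumr_ge0.
have := @expectation_input e k (fun=> 1); rewrite -!mulr_suml !mulr1 => <-.
exact: P_sum1.
Qed.

Lemma out_law_marginal e k v : out_law (@in_marginal e k) v = out_marginal k v.
Proof.
rewrite /out_law -(expectation_input k (fun a => chan net e a v)).
have eq1 := @one_step e k (fun _ y => (y == v)%:R) (fun _ _ _ _ => erefl).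
rewrite /out_marginal /Pr [RHS]big_mkcond /=.
transitivity (\sum_o P o * (Y e k o == v)%:R); last first.
  by apply: eq_bigr => o _; rewrite mulr_natr mulrb.
rewrite eq1; apply: eq_bigr => o _; congr (_ * _).
rewrite (bigD1 v) //= eqxx mulr1 big1 ?addr0 // => y /negPf ->.
by rewrite mulr0.
Qed.

(** The left side equals [ln 2] times the mutual information of this single use under its actual
    input law [in_marginal]. *)
Lemma expectation_ln_ratio e k :
  - (\sum_o P o * ln (ratio e k o)) <= ln 2 * capacity net e.
Proof.
rewrite (one_step (e := e) (k := k)
  (G := fun o v => ln (out_marginal k v / chan net e (X e k o) v))); last first.
  by move=> o1 o2 v [_ ->].
rewrite (expectation_input k (fun a => \sum_v chan net e a v *
  ln (out_marginal k v / chan net e a v))).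
have := information_le_capacity (@in_marginal_pmf e k).
rewrite -(ler_pM2l (ln2_gt0 R)); apply: le_trans.
rewrite le_eqVlt; apply/orP; left; apply/eqP.
rewrite /information mulr_sumr -sumrN; apply: eq_bigr => a _.
rewrite !mulr_sumr -sumrN; apply: eq_bigr => v _.
have [mu0 _] := @in_marginal_pmf e k; have [c0 _] := chan_pmf a.
rewrite mulrA -mulrN.
have [->|pc_neq0] := eqVneq (in_marginal k a * chan net e a v) 0.
  by rewrite !mul0r mulr0.
have pc_gt0 : 0 < in_marginal k a * chan net e a v.
  by rewrite lt0r pc_neq0 mulr_ge0.
have ca : 0 < chan net e a v.
  by rewrite lt0r c0 andbT; apply: contraNneq pc_neq0 => ->; rewrite mulr0.
have om : 0 < out_marginal k v.
  rewrite -out_law_marginal; apply: lt_le_trans pc_gt0 _.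
  exact/out_law_ge/in_marginal_pmf.
rewrite /log2 out_law_marginal mulrCA; congr (_ * _).
rewrite mulrCA divff ?mulr1 ?gt_eqF ?ln2_gt0 //.
by rewrite -[in RHS](invrK (_ / _)) lnV ?posrE ?invr_gt0 ?divr_gt0 // invf_div.
Qed.

Lemma ratio_gt0 e k o : 0 < P o -> 0 < ratio e k o.
Proof.
move=> Po; rewrite divr_gt0 //.
  by rewrite /out_marginal /Pr (bigD1 o) //= ltr_pwDl // sumr_ge0.
rewrite lt0r; case: (chan_pmf (X e k o)) => -> _; rewrite andbT.
(* By [one_step], outputs to which the channel gives probability 0 have total probability 0. *)
apply/eqP => c0; have := one_step (e := e) (k := k)
  (G := fun o v => (chan net e (X e k o) v == 0)%:R).
move=> /(_ (fun o1 o2 v h => congr1 (fun x => (chan net e x v == 0)%:R)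
   (let: And3 _ h2 _ := h in h2))).
rewrite [RHS]big1 => [/psumr_eq0P /(_ o)|o' _]; last first.
  rewrite big1 ?mulr0 // => v _.
  by case: eqP => [->|]; rewrite ?mul0r ?mulr0.
rewrite c0 eqxx mulr1 => P0; move: Po; rewrite P0 ?ltxx // => o' _.
by rewrite mulr_ge0.
Qed.

Lemma weight_ln : - (\sum_o P o * ln (weight horizon o)) <=
  ln 2 * (n%:R * \sum_(e | cut_edge e) capacity net e).
Proof.
have -> : \sum_o P o * ln (weight horizon o) =
    \sum_(ek : edge N * 'I_n | cut_edge ek.1) \sum_o P o * ln (ratio ek.1 ek.2 o).
  rewrite exchange_big /=; apply: eq_bigr => o _; rewrite -mulr_sumr.
  have [->|P0] := eqVneq (P o) 0; first by rewrite !mul0r.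
  congr (_ * _); rewrite /weight.
  under eq_bigl => ek do rewrite stage_max andbT.
  have Po : 0 < P o by rewrite lt0r P0 P_ge0.
  apply: (@proj2 (0 < \prod_(ek : edge N * 'I_n | cut_edge ek.1) ratio ek.1 ek.2 o)).
  elim/big_rec2: _ => [|ek y1 y2 _ [y2_gt0 <-]]; first by rewrite ln1 ltr01.
  by rewrite mulr_gt0 ?ratio_gt0 // lnM ?posrE ?ratio_gt0.
rewrite -sumrN.
apply: (@le_trans _ _ (\sum_(ek : edge N * 'I_n | cut_edge ek.1)
   ln 2 * capacity net ek.1)).
  by apply: ler_sum => ek _; apply: expectation_ln_ratio.
rewrite -mulr_sumr ler_pM2l ?ln2_gt0 //.
rewrite (eq_bigl (fun ek => cut_edge ek.1 && xpredT ek.2)); last first.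
  by move=> ek; rewrite andbT.
rewrite -(pair_big cut_edge xpredT (fun e (k : 'I_n) => capacity net e)) /=.
under eq_bigr => e _ do rewrite sumr_const card_ord.
by rewrite sumrMnl mulr_natl.
Qed.

Lemma weight_gt0 o : 0 < P o -> 0 < weight horizon o.
Proof. by move=> Po; apply: prodr_gt0 => ek _; apply: ratio_gt0. Qed.

Notation agree_off := (@agree_off N (msize c) T).

Lemma weight_expectation_le (f : messages (msize c) -> outputs -> R) (a : R) :
  (forall w, local_at_sinks (f w)) -> (forall w y, 0 <= f w y) ->
  (forall y, \sum_w value (f w) w horizon y <= #|messages (msize c)|%:R * a) ->
  \sum_o P o * (weight horizon o * f (messages_of o) (outputs_of o)) <= a.
Proof.
move=> f_loc f0 le_a; pose y0 : outputs := fun e _ => out0 net e.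
have M0 : 0 < #|messages (msize c)|%:R :> R by rewrite ltr0n (messages_gt0 (msize_gt0 c)).
apply: (@le_trans _ _ (\sum_w (#|messages (msize c)|%:R)^-1 *
    value (f w) w horizon y0)); last first.
  by rewrite -mulr_sumr ler_pdivrMl.
rewrite (eq_bigr (fun o => \sum_w P o * (weight horizon o *
    (messages_of o == w)%:R * f w (outputs_of o)))) => [|o _]; last first.
  rewrite (bigD1 (messages_of o)) //= eqxx mulr1 big1 ?addr0 // => w.
  by rewrite eq_sym => /negPf ->; rewrite mulr0 mul0r mulr0.
by rewrite exchange_big /=; apply: ler_sum => w _; apply: weight_le_value.
Qed.

Lemma value_sum1 y : \sum_w value (fun=> 1) w horizon y <=
  #|messages (msize c)|%:R * 1.
Proof.
rewrite mulr1 (_ : #|_|%:R = \sum_(w : messages (msize c)) 1); last first.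
  by rewrite sumr_const.
apply: ler_sum => w _.
have : \sum_(w' in [set w]%SET) value (fun=> 1) w' horizon y <= 1.
  apply: (@value_sum_le1 _ w (fun _ _ => 1)) => [w' i|_]; last by rewrite big_set1.
  by rewrite inE => /eqP ->.
by rewrite big_set1.
Qed.

Variables (D : {set 'I_N}) (d : 'I_N).
Hypotheses (dD : d \in D) (dT : d \notin T).

Definition correct_at (w : messages (msize c)) (y : outputs) : R :=
  [forall (i | i \in T),
     dec i (w d) (fun l => [tuple y (l, d) s | s < n]) == w i]%:R.

Lemma correct_at_local w : local_at_sinks (correct_at w).
Proof.
move=> y y' yy'; rewrite /correct_at; congr (nat_of_bool _)%:R.
apply: eq_forallb => i; congr (_ ==> (dec _ _ _ == _)).
apply: functional_extensionality_dep => l.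
by apply: eq_from_tnth => s; rewrite !tnth_mktuple; apply: yy'.
Qed.

Notation MT := (\prod_(i in T) msize c i)%N.

Lemma MT_gt0 : (0 < MT)%N.
Proof. by rewrite prodn_gt0 // => i; apply: msize_gt0. Qed.

(** Double counting over the classes [agree_off w], all of the same size. Within a class the decoder
    at [d] has the same own message and the same outputs, so it is right for at most one tuple. *)
Lemma value_correct y : \sum_w value (correct_at w) w horizon y <=
  #|messages (msize c)|%:R * MT%:R^-1.
Proof.
rewrite ler_pdivlMr ?ltr0n ?MT_gt0 //.
have -> : (\sum_w value (correct_at w) w horizon y) * MT%:R =
    \sum_w \sum_(w' in agree_off w) value (correct_at w') w' horizon y.
  rewrite (exchange_big_dep xpredT) //= mulr_suml; apply: eq_bigr => w' _.
  under [RHS]eq_bigl => w do rewrite agree_off_sym.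
  by rewrite sumr_const card_agree_off mulr_natr.
rewrite (_ : #|_|%:R = \sum_(w : messages (msize c)) 1); last first.
  by rewrite sumr_const.
apply: ler_sum => w _.
apply: (@value_sum_le1 (agree_off w) w correct_at).
  by move=> w' i; rewrite inE => /forallP/(_ i)/implyP h /h/eqP.
move=> y'; case: (pickP [pred w' in agree_off w | correct_at w' y' != 0]).
  move=> w1 /andP[/= w1S c1]; rewrite (bigD1 w1) //= big1 ?addr0.
    by rewrite /correct_at lern1 leq_b1.
  move=> w2 /andP[w2S ne]; apply: contraNeq ne => c2.
  move: c1 c2; rewrite /correct_at !pnatr_eq0 !eqb0 !negbK.
  move=> /forallP c1 /forallP c2; apply/eqP/ffunP => i.
  move: w1S w2S; rewrite !inE => /forallP w1S /forallP w2S.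
  have w1w2 j : j \notin T -> w2 j = w1 j.
    move=> jT; have := w1S j; have := w2S j; rewrite jT /=.
    by move=> /eqP -> /eqP ->.
  have [iT|iT] := boolP (i \in T); last exact: w1w2.
  have := c1 i; have := c2 i; rewrite iT /= (w1w2 d dT).
  by move=> /eqP <- /eqP <-.
move=> none; rewrite big1 ?ler01 // => w' w'S; apply/eqP; apply: contraFT (none w').
by rewrite /= w'S.
Qed.

Lemma converse_bound :
  (1 - error_prob D r) * ln (MT%:R : R) <=
  ln 2 * (1 + n%:R * \sum_(e | cut_edge e) capacity net e).
Proof.
pose fc o := correct_at (messages_of o) (outputs_of o).
have fc01 o : fc o = 0 \/ fc o = 1.
  rewrite /fc /correct_at; set b := FiniteQuant.quant0b _.
  by case: b; [right|left].
have fc0 o : 0 <= fc o by case: (fc01 o) => ->.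
have fc1 o : 0 <= 1 - fc o by case: (fc01 o) => ->; rewrite ?subr0 ?subrr.
have M1 : 1 <= MT%:R :> R by rewrite ler1n MT_gt0.
have M0 : 0 < MT%:R :> R by rewrite ltr0n MT_gt0.
have err_le : 1 - error_prob D r <= \sum_o P o * fc o.
  rewrite lerBlDr -[leLHS]P_sum1 /error_prob /Pr -/P [X in _ + X]big_mkcond /=.
  rewrite -big_split /=; apply: ler_sum => o _.
  case: ifPn => err; first by rewrite lerDr mulr_ge0.
  rewrite addr0 /fc /correct_at; set b := FiniteQuant.quant0b _.
  suff -> : b by rewrite mulr1.
  apply/forallP => i; apply/implyP => iT.
  (* The error event tests sources only; any other node has a single message and cannot be decoded
     wrongly. *)
  have [iV|/msize_notin Mi] := boolP (i \in V); last first.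
    by apply/eqP/ord_inj; move: (dec _ _ _) (messages_of o i);
       rewrite Mi => -[[] // ?] [[] // ?].
  apply: contraNT err => ne; apply/existsP; exists i; rewrite iV /=.
  apply/existsP; exists d; rewrite dD /= /decoded.
  by move: ne; rewrite /messages_of !ffunE.
(* Correct decoding has probability at most [1 / MT] under the comparison law, so rewarding it by
   [MT] keeps the mean of the numerator at most 2. The division by 2 becomes the additive 1 of the
   bound. *)
pose g o := weight horizon o * (MT%:R * fc o + (1 - fc o)) / 2.
have g_le1 : \sum_o P o * g o <= 1.
  have e1 := @weight_expectation_le correct_at (MT%:R^-1) correct_at_local
    (fun _ _ => ler0n _ _) value_correct.
  have e2 := @weight_expectation_le (fun _ _ => 1) 1 (fun _ _ _ _ => erefl)
    (fun _ _ => ler01) value_sum1.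
  rewrite -/fc in e1.
  have -> : \sum_o P o * g o = (MT%:R * \sum_o P o * (weight horizon o * fc o) +
      \sum_o P o * (weight horizon o * (1 - fc o))) / 2.
    rewrite mulr_sumr -big_split /= mulr_suml; apply: eq_bigr => o _.
    by rewrite /g; ring.
  rewrite ler_pdivrMr // mul1r -[leRHS]/(1 + 1) lerD //.
    by rewrite -ler_pdivlMl // mulr1.
  apply: le_trans e2; apply: ler_sum => o _; rewrite ler_wpM2l //.
  by rewrite ler_wpM2l ?weight_ge0 // gerBl.
have ln_g o : 0 < P o ->
    ln (g o) = ln (weight horizon o) + fc o * ln MT%:R - ln 2.
  move=> Po; have w0 := weight_gt0 Po; rewrite /g.
  have h0 : 0 < MT%:R * fc o + (1 - fc o).
    by case: (fc01 o) => ->; rewrite ?mulr0 ?mulr1 ?subr0 ?subrr ?addr0 ?add0r.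
  rewrite ln_div ?posrE ?mulr_gt0 // lnM ?posrE //; congr (_ + _ - _).
  case: (fc01 o) => ->; first by rewrite mulr0 subr0 add0r ln1 mul0r.
  by rewrite mulr1 subrr addr0 mul1r.
have : \sum_o P o * ln (g o) <= 0.
  apply: (@le_trans _ _ (\sum_o P o * (g o - 1))); last first.
    under eq_bigr => o _ do rewrite mulrBr mulr1.
    by rewrite sumrB P_sum1 subr_le0.
  apply: ler_sum => o _; have := P_ge0 o; rewrite le_eqVlt => /predU1P[<-|Po].
    by rewrite !mul0r.
  rewrite ler_pM2l //; apply: ln_le_subr1; rewrite /g.
  rewrite divr_gt0 // mulr_gt0 ?weight_gt0 //.
  by case: (fc01 o) => ->; rewrite ?mulr0 ?mulr1 ?subr0 ?subrr ?addr0 ?add0r.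
have -> : \sum_o P o * ln (g o) = \sum_o P o * ln (weight horizon o) +
    (\sum_o P o * fc o) * ln MT%:R - ln 2.
  rewrite -[X in _ - X]mul1r -[X in _ - X * _]P_sum1 !mulr_suml -big_split -sumrB /=.
  apply: eq_bigr => o _; have := P_ge0 o; rewrite le_eqVlt => /predU1P[<-|Po].
    by rewrite !mul0r addr0 subr0.
  by rewrite ln_g //; ring.
have lnM0 : 0 <= ln (MT%:R : R) by rewrite ln_ge0.
have := ler_wpM2r lnM0 err_le; have := weight_ln.
move: (\sum_o P o * ln _) (_ * ln _) (_ * ln _) => a b b'.
rewrite mulrDr mulr1; move: (ln 2 * (_ * _)) => z; lra.
Qed.

End Converse.

(** * Channel coding *)

Section Feinstein.
Variables (R : realType) (A B : finType) (a0 : A).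
Variables (K : A -> B -> R) (pA : A -> R) (qB : B -> R) (G : A -> pred B).
Variables (gamma eps eps1 : R).
Hypothesis K_ge0 : forall a b, 0 <= K a b.
Hypothesis K_pmf : forall a, \sum_b K a b = 1.
Hypothesis pA_pmf : is_pmf pA.
Hypothesis qBE : forall b, qB b = \sum_a pA a * K a b.
Hypothesis gamma_gt0 : 0 < gamma.
Hypothesis dense : forall a b, G a b -> gamma * qB b <= K a b.
Hypothesis atypical :
  \sum_a pA a * (\sum_b K a b * (~~ G a b)%:R) <= eps1.

(* Codewords are added greedily: as long as the decoding regions in use have
   small [qB]-mass, some input is decodable outside of them. Output [b] is
   decoded to [dec b] if this is less than [M]. *)
Lemma greedy_code (M : nat) : M%:R / gamma + eps1 <= eps ->
  exists (enc : nat -> A) (dec : B -> nat),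
    (forall i, (i < M)%N -> \sum_b K (enc i) b * (dec b != i)%:R <= eps) /\
    (forall b, (dec b < M)%N -> G (enc (dec b)) b).
Proof.
elim: M => [_|M IH le_eps]; first by exists (fun=> a0), (fun=> 0%N).
have le_epsM : M%:R / gamma + eps1 <= eps.
  by apply: le_trans le_eps; rewrite lerD2r ler_pM2r ?invr_gt0 // ler_nat.
have [enc [dec [enc_ok dec_ok]]] := IH le_epsM.
(* A decoding region lies where [gamma * qB <= K], and [K] has mass at most 1 there, so each region
   has [qB]-mass at most [1 / gamma]. *)
have used_le : \sum_(b | (dec b < M)%N) qB b <= M%:R / gamma.
  rewrite ler_pdivlMr // mulrC mulr_sumr.
  apply: (@le_trans _ _ (\sum_(b | (dec b < M)%N) K (enc (dec b)) b)).
    by apply: ler_sum => b /dec_ok; apply: dense.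
  have -> : M%:R = \sum_(i < M) 1 :> R by rewrite sumr_const card_ord.
  rewrite big_mkcond /=.
  apply: (@le_trans _ _ (\sum_b \sum_(i < M) (K (enc i) b * (dec b == i)%:R))).
    apply: ler_sum => b _; case: ltnP => [lt_b|_]; last first.
      by apply: sumr_ge0 => i _; rewrite mulr_ge0.
    rewrite (bigD1 (Ordinal lt_b)) //= eqxx mulr1 lerDl sumr_ge0 // => i _.
    by rewrite mulr_ge0.
  rewrite exchange_big /=; apply: ler_sum => i _; rewrite -[leRHS](K_pmf (enc i)).
  by apply: ler_sum => b _; rewrite ler_piMr // lern1 leq_b1.
have : \sum_a pA a * (\sum_b K a b * ((~~ G a b) || (dec b < M)%N)%:R) <= eps.
  apply: le_trans le_epsM; rewrite addrC.
  apply: le_trans (lerD atypical used_le).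
  under [X in _ <= _ + X]eq_bigr => b _ do rewrite qBE.
  rewrite exchange_big /= -big_split /=; apply: ler_sum => a _.
  rewrite -mulr_sumr -mulrDr ler_wpM2l ?(proj1 pA_pmf) //.
  rewrite [X in _ <= _ + X]big_mkcond -big_split /=; apply: ler_sum => b _.
  by case: (G a b); case: (_ < _)%N;
    rewrite /= ?mulr1 ?mulr0 ?addr0 ?add0r // lerDl.
move/(is_pmf_support pA_pmf) => [a _ le_a].
exists (fun i => if i == M then a else enc i).
(* The value [M.+1] marks outputs still undecoded; earlier codewords keep their regions. *)
exists (fun b => if (dec b < M)%N then dec b else if G a b then M else M.+1).
split=> [i|b].
  rewrite ltnS leq_eqVlt => /predU1P[->|iM].
    rewrite eqxx; apply: le_trans le_a; apply: ler_sum => b _.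
    rewrite ler_wpM2l // ler_nat; case: ltnP => decM; first by rewrite orbT leq_b1.
    by case: (G a b); rewrite ?eqxx //= leq_b1.
  rewrite (ltn_eqF iM); apply: le_trans (enc_ok i iM); apply: ler_sum => b _.
  rewrite ler_wpM2l // ler_nat; case: ltnP => // decM.
  by rewrite (_ : (dec b != i)) ?leq_b1 // neq_ltn (leq_trans iM decM) orbT.
case: (ltnP (dec b) M) => [decM _|decM]; first by rewrite (ltn_eqF decM) dec_ok.
by case: ifPn => [|_]; rewrite ?eqxx // ltnn.
Qed.

End Feinstein.

Section Chebyshev.
Variables (R : realType) (Z : finType) (p : Z -> R) (g : Z -> R) (m : nat).
Hypothesis p_pmf : is_pmf p.
Hypothesis g_mean : \sum_z p z * g z = 0.

Notation mu := (prod_pmf (fun _ : 'I_m => p)).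

(** Cross terms vanish: redrawing coordinate [t] alone averages [g (z t)] to 0. *)
Lemma sum_variance :
  \sum_z mu z * (\sum_s g (z s)) ^+ 2 = m%:R * \sum_z p z * g z ^+ 2.
Proof.
have pp (i : 'I_m) : is_pmf p by [].
have -> : m%:R * (\sum_z p z * g z ^+ 2) =
    \sum_(s < m) \sum_(t < m) \sum_z mu z * (g (z s) * g (z t)).
  transitivity (\sum_(s < m) \sum_z p z * g z ^+ 2).
    by rewrite sumr_const card_ord mulr_natl.
  apply: eq_bigr => s _; rewrite (bigD1 s) //= [X in _ + X]big1 ?addr0.
    by rewrite (prod_pmf_expect1 pp s (fun z => g z * g z)).
  move=> t ts; rewrite (resample pp [set t]%SET) big1 // => u _.
  have st : s \notin [set t]%SET by rewrite inE eq_sym.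
  under eq_bigr => v _ do
    rewrite (mix_notin _ _ st) (mix_in _ _ (finset.set11 t)) mulrCA.
  by rewrite -mulr_sumr (prod_pmf_expect1 pp t g) g_mean !mulr0.
under [RHS]eq_bigr => s _ do rewrite exchange_big /=.
rewrite [RHS]exchange_big /=; apply: eq_bigr => z _.
under [RHS]eq_bigr => s _ do rewrite -mulr_sumr.
rewrite -mulr_sumr expr2 mulr_suml; congr (_ * _).
by apply: eq_bigr => s _; rewrite mulr_sumr.
Qed.

Lemma chebyshev_sum (eta : R) : 0 < eta -> (0 < m)%N ->
  \sum_z mu z * (\sum_s g (z s) <= - (m%:R * eta))%R%:R <=
  (\sum_z p z * g z ^+ 2) / (m%:R * eta ^+ 2).
Proof.
move=> eta0 m0; have m0R : 0 < m%:R :> R by rewrite ltr0n.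
have me : 0 < m%:R * eta by rewrite mulr_gt0.
have -> : (\sum_z p z * g z ^+ 2) / (m%:R * eta ^+ 2) =
    (\sum_z mu z * (\sum_s g (z s)) ^+ 2) / (m%:R * eta) ^+ 2.
  by rewrite sum_variance; field; rewrite !gt_eqF.
rewrite ler_pdivlMr ?exprn_gt0 // mulr_suml; apply: ler_sum => z _.
rewrite -mulrA ler_wpM2l ?prod_pmf_ge0 //.
case: (boolP (\sum_s g (z s) <= _)) => [le_s|_]; last by rewrite mul0r sqr_ge0.
rewrite mul1r -[leRHS]sqrrN ler_pXn2r ?nnegrE //; first by rewrite lerNr.
  exact: ltW.
by rewrite oppr_ge0 (le_trans le_s) // oppr_le0 ltW.
Qed.
End Chebyshev.

Section ChannelCode.
Variables (R : realType) (N : nat) (net : network R N) (e : edge N).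

Definition block_chan (m : nat) (x : {ffun 'I_m -> inp net e})
    (y : {ffun 'I_m -> out net e}) : R := \prod_s chan net e (x s) (y s).

Lemma sum_ffun_pair (m : nat) (A B : finType)
    (F : {ffun 'I_m -> A} -> {ffun 'I_m -> B} -> R) :
  \sum_x \sum_y F x y =
  \sum_(z : {ffun 'I_m -> A * B}) F [ffun s => (z s).1] [ffun s => (z s).2].
Proof.
rewrite pair_big /=.
pose h (z : {ffun 'I_m -> A * B}) : {ffun 'I_m -> A} * {ffun 'I_m -> B} :=
  ([ffun s => (z s).1], [ffun s => (z s).2]).
rewrite (reindex h) //=.
exists (fun xy : {ffun 'I_m -> A} * {ffun 'I_m -> B} =>
  [ffun s => (xy.1 s, xy.2 s)]) => [z _|[x y] _].
  by apply/ffunP => s; rewrite !ffunE; case: (z s).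
by congr pair; apply/ffunP => s; rewrite !ffunE.
Qed.

Section TypicalCode.
Variables (p : inp net e -> R) (p_pmf : is_pmf p).

Definition density (z : inp net e * out net e) : R :=
  ln (chan net e z.1 z.2 / out_law p z.2).

Definition joint (z : inp net e * out net e) : R := p z.1 * chan net e z.1 z.2.

Lemma joint_pmf : is_pmf joint.
Proof.
have [p0 p1] := p_pmf; split=> [z|].
  by rewrite mulr_ge0 //; case: (chan_pmf z.1).
rewrite -(pair_big xpredT xpredT (fun x y => p x * chan net e x y)) /= -[RHS]p1.
by apply: eq_bigr => x _; rewrite -mulr_sumr (proj2 (chan_pmf x)) mulr1.
Qed.

Lemma density_mean : \sum_z joint z * density z = ln 2 * information p.
Proof.
rewrite -(pair_big xpredT xpredT (fun x y => joint (x, y) * density (x, y))) /=.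
rewrite mulr_sumr; apply: eq_bigr => x _; rewrite mulr_sumr; apply: eq_bigr => y _.
rewrite /joint /density /log2 /= mulrCA; congr (_ * _).
by rewrite mulrCA divff ?mulr1 // gt_eqF ?ln2_gt0.
Qed.

Definition variance : R :=
  \sum_z joint z * (density z - ln 2 * information p) ^+ 2.

Lemma variance_ge0 : 0 <= variance.
Proof.
by apply: sumr_ge0 => z _; rewrite mulr_ge0 ?sqr_ge0 //; case: joint_pmf.
Qed.

Lemma typical_code (m M : nat) (eta eps : R) : 0 < eta -> (0 < m)%N ->
  M%:R / expR (m%:R * (ln 2 * information p - eta)) +
    variance / (m%:R * eta ^+ 2) <= eps ->
  exists (enc : nat -> {ffun 'I_m -> inp net e})
         (dec : {ffun 'I_m -> out net e} -> nat),
    forall i, (i < M)%N ->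
    \sum_y block_chan (enc i) y * (dec y != i)%:R <= eps.
Proof.
move=> eta0 m0 le_eps.
have [p0 p1] := p_pmf.
have chan0 x y : 0 <= chan net e x y by case: (chan_pmf x).
pose mu := ln 2 * information p.
pose gamma := expR (m%:R * (mu - eta)).
(* Positivity is demanded separately because [ln 0 = 0]: an impossible letter would otherwise have
   density 0 instead of minus infinity. *)
pose G (x : {ffun 'I_m -> inp net e}) : pred {ffun 'I_m -> out net e} := fun y =>
  [forall s, 0 < chan net e (x s) (y s)] &&
  (m%:R * (mu - eta) <= \sum_s density (x s, y s)).
pose qB (y : {ffun 'I_m -> out net e}) := \prod_s out_law p (y s).
have K0 (x : {ffun 'I_m -> inp net e}) y : 0 <= block_chan x y.
  by apply: prodr_ge0 => s _.
have K1 (x : {ffun 'I_m -> inp net e}) : \sum_y block_chan x y = 1.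
  rewrite /block_chan -(bigA_distr_bigA (fun s y => chan net e (x s) y)).
  by apply: big1 => s _; case: (chan_pmf (x s)).
have pm_pmf := @prod_pmf_is_pmf R 'I_m _ (fun=> p) (fun=> p_pmf).
have qBE y : qB y = \sum_x prod_pmf (fun=> p) x * block_chan x y.
  rewrite /qB /out_law (bigA_distr_bigA (fun s x => p x * chan net e x (y s))).
  by apply: eq_bigr => x _; rewrite -big_split.
have dense x y : G x y -> gamma * qB y <= block_chan x y.
  move=> /andP[/forallP c_gt0 typ].
  have q0 s : 0 <= out_law p (y s) by case: (out_law_pmf p_pmf).
  have [/existsP[s /eqP qs]|/existsPn q_neq0] := boolP [exists s, out_law p (y s) == 0].
    by rewrite /qB (bigD1 s) //= qs mul0r mulr0.
  have q_gt0 s : 0 < out_law p (y s) by rewrite lt0r q_neq0 q0.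
  have -> : block_chan x y = expR (\sum_s density (x s, y s)) * qB y.
    rewrite expR_sum -big_split /=; apply: eq_bigr => s _.
    by rewrite /density /= lnK ?posrE ?divr_gt0 // divfK // gt_eqF.
  by rewrite ler_wpM2r ?ler_expR // prodr_ge0.
pose g z := density z - mu.
have g_mean : \sum_z joint z * g z = 0.
  under eq_bigr => z _ do rewrite mulrBr.
  by rewrite sumrB -mulr_suml (proj2 joint_pmf) mul1r density_mean subrr.
have atypical : \sum_x prod_pmf (fun=> p) x *
    (\sum_y block_chan x y * (~~ G x y)%:R) <= variance / (m%:R * eta ^+ 2).
  apply: le_trans (chebyshev_sum joint_pmf g_mean eta0 m0).
  under eq_bigr => x _ do rewrite mulr_sumr.
  rewrite sum_ffun_pair; apply: ler_sum => z _; rewrite mulrA.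
  have -> : prod_pmf (fun=> p) [ffun s => (z s).1] *
      block_chan [ffun s => (z s).1] [ffun s => (z s).2] = prod_pmf (fun=> joint) z.
    by rewrite /prod_pmf /block_chan -big_split /=; apply: eq_bigr => s _; rewrite !ffunE.
  have [->|nz] := eqVneq (prod_pmf (fun=> joint) z) 0; first by rewrite !mul0r.
  rewrite ler_wpM2l ?(prod_pmf_ge0 (fun=> joint_pmf)) // ler_nat /G.
  rewrite (_ : [forall s, _] = true) /=; last first.
    apply/forallP => s; rewrite !ffunE lt0r chan0 andbT.
    apply: contraNneq nz => c0.
    by rewrite /prod_pmf (bigD1 s) //= /joint c0 mulr0 mul0r.
  have -> : \sum_s density ([ffun s => (z s).1] s, [ffun s => (z s).2] s) =
      \sum_s g (z s) + m%:R * mu.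
    have -> : m%:R * mu = \sum_(s < m) mu by rewrite sumr_const card_ord mulr_natl.
    rewrite -big_split /=.
    by apply: eq_bigr => s _; rewrite !ffunE /g subrK -surjective_pairing.
  case: (leP (m%:R * (mu - eta)) _) => //= lt_s.
  suff -> : \sum_s g (z s) <= - (m%:R * eta) by [].
  by move: lt_s; rewrite mulrBr; lra.
have [enc [dec [enc_ok _]]] := @greedy_code R _ _ [ffun=> inp0 net e]
  (@block_chan m) _ qB G gamma eps _ K0 K1 pm_pmf qBE (expR_gt0 _) dense atypical
  M le_eps.
by exists enc, dec.
Qed.

End TypicalCode.

(** The case [q = 1] is for target rates too small for two codewords: rounding then leaves a single
    codeword, which is never mistaken. *)
Lemma channel_code (delta eps : R) : 0 < delta -> 0 < eps ->
  exists m0 : nat, forall m, (m0 <= m)%N -> forall q : nat,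
  q = 1%N \/ q%:R <= expR (m%:R * (ln 2 * (capacity net e - delta))) ->
  exists (enc : nat -> {ffun 'I_m -> inp net e})
         (dec : {ffun 'I_m -> out net e} -> nat),
    forall i, (i < q)%N ->
    \sum_y block_chan (enc i) y * (dec y != i)%:R <= eps.
Proof.
(* One third of [delta] pays for an input law short of capacity, one for the typicality margin
   [eta], and one yields the factor [expR (- (m%:R * eta))], pushed below [eps / 2]. *)
move=> d0 e0; have d3 : 0 < delta / 3 by rewrite divr_gt0.
have [p p_pmf lt_p] := capacity_approx net e d3.
have [eta etaE] : exists eta, eta = ln 2 * (delta / 3) by eexists.
have eta0 : 0 < eta by rewrite etaE mulr_gt0 ?ln2_gt0.
pose K1 := 2 / (eps * eta); pose K2 := 2 * variance p / (eps * eta ^+ 2).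
have K10 : 0 <= K1 by rewrite divr_ge0 // mulr_ge0 // ltW.
have K20 : 0 <= K2.
  rewrite divr_ge0 // mulr_ge0 ?variance_ge0 ?exprn_ge0 //; exact: ltW.
exists (Num.bound K1 + Num.bound K2).+1 => m m_ge q q_le.
have m0 : (0 < m)%N by apply: leq_trans m_ge.
have m0R : 0 < m%:R :> R by rewrite ltr0n.
have mK1 : K1 <= m%:R.
  apply: le_trans (ltW (archi_boundP K10)) _; rewrite ler_nat.
  by apply: leq_trans m_ge; rewrite leqW // leq_addr.
have mK2 : K2 <= m%:R.
  apply: le_trans (ltW (archi_boundP K20)) _; rewrite ler_nat.
  by apply: leq_trans m_ge; rewrite leqW // leq_addl.
case: q_le => [->|q_le].
  exists (fun=> [ffun=> inp0 net e]), (fun=> 0%N) => i; rewrite ltnS leqn0 => /eqP ->.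
  rewrite big1; first exact: ltW.
  by move=> y _; rewrite eqxx mulr0.
apply: (typical_code p_pmf eta0 m0).
have -> : eps = eps / 2 + eps / 2 by rewrite -splitr.
apply: lerD; last first.
  rewrite ler_pdivrMr ?mulr_gt0 ?exprn_gt0 //.
  move: mK2; rewrite /K2 ler_pdivrMr ?mulr_gt0 ?exprn_gt0 // => h.
  rewrite mulrAC ler_pdivlMr // mulrC; apply: le_trans h _.
  by rewrite mulrCA.
rewrite ler_pdivrMr ?expR_gt0 //; apply: le_trans q_le _.
have e_eta : expR (- (m%:R * eta)) <= eps / 2.
  have me : 0 < m%:R * eta by rewrite mulr_gt0.
  rewrite expRN invf_ple ?posrE ?expR_gt0 ?divr_gt0 // invf_div.
  apply: (@le_trans _ _ (m%:R * eta)).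
    move: mK1; rewrite /K1 ler_pdivrMr ?mulr_gt0 // => h.
    by rewrite ler_pdivrMr // mulrAC -mulrA.
  by apply: le_trans (expR_ge1Dx _); rewrite lerDr.
apply: (@le_trans _ _ (expR (- (m%:R * eta)) *
    expR (m%:R * (ln 2 * information p - eta)))); last first.
  by rewrite ler_wpM2r // expR_ge0.
rewrite -expRD ler_expR -mulrN -mulrDr ler_wpM2l // etaE.
have l2 := ln2_gt0 R; have := ltW lt_p; rewrite -(ler_pM2l l2) => h.
move: (ln 2) (information p) h l2 => l I h l2; move: h; nra.
Qed.

End ChannelCode.

(** * Random network coding on noiseless links *)

Section RandomNetworkCode.
Variables (R : realType) (N L : nat) (W S0 A : finType) (a0 : A).
Variable own : 'I_N -> W -> S0.

(** Blocks not yet received are padded with [a0], so states have the same finite type at all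
    times. *)
Definition link_state : finType := (S0 * {ffun 'I_L * 'I_N -> A})%type.

Definition state (s : S0) (r : 'I_L -> edge N -> A) (i : 'I_N) (b : nat) :
    link_state :=
  (s, [ffun x : 'I_L * 'I_N => if (x.1 < b)%N then r x.1 (x.2, i) else a0]).

Lemma eq_state s r r' i b :
  (forall (b' : 'I_L) l, (b' < b)%N -> r b' (l, i) = r' b' (l, i)) ->
  state s r i b = state s r' i b.
Proof.
by move=> rr'; congr pair; apply/ffunP => x; rewrite !ffunE; case: ifP => // /rr'.
Qed.

(** A random function is a table with one symbol per edge, block and sender state; distinct states
    get independent symbols. *)
Definition link_coord : finType := (edge N * 'I_L * link_state)%type.
Definition link_code : finType := {ffun link_coord -> A}.

Definition relay (phi : link_code) (w : W) (b : 'I_L) (r : 'I_L -> edge N -> A) :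
    edge N -> A :=
  fun e => phi (e, b, state (own e.1 w) r e.1 b).

Lemma relay_causal phi w : causal (relay phi w).
Proof.
move=> k y y' yy'; apply/funext => e; rewrite /relay.
by rewrite (@eq_state _ y y') // => b l /yy' ->.
Qed.

Definition run phi w := causal_sol (fun=> a0) (relay phi w).

Lemma runE phi w b e : run phi w b e = phi (e, b, state (own e.1 w) (run phi w) e.1 b).
Proof. by rewrite {1}/run causal_solE //; apply: relay_causal. Qed.

Definition final phi w i b := state (own i w) (run phi w) i b.

Definition separated phi w w' b : {set 'I_N} :=
  [set i | final phi w i b != final phi w' i b]%SET.

Lemma separated_sub phi w w' b b' : (b <= b')%N ->
  separated phi w w' b \subset separated phi w w' b'.
Proof.
move=> bb'; apply/fintype.subsetP => i; rewrite !inE; apply: contraNN => /eqP[e1 e2].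
rewrite /final /state e1; apply/eqP; congr pair; apply/ffunP => x; rewrite !ffunE.
case: ifP => // xb; move/ffunP: e2 => /(_ x); rewrite !ffunE.
by rewrite (leq_trans xb bb').
Qed.

Lemma separated0 phi w w' :
  separated phi w w' 0 = [set i | own i w != own i w']%SET.
Proof.
apply/setP => i; rewrite !inE /final /state; congr negb.
apply/eqP/eqP => [[->]|->] //.
Qed.

Lemma separated_edge phi w w' (b : 'I_L) (i j : 'I_N) :
  j \notin separated phi w w' b.+1 -> run phi w b (i, j) = run phi w' b (i, j).
Proof.
rewrite inE negbK => /eqP[_ /ffunP/(_ (b, i))]; by rewrite !ffunE /= ltnSn.
Qed.

Definition block_coords (b : 'I_L) : {set link_coord} :=
  [set c | c.1.2 == b]%SET.

Lemma run_mix phi v w (b s : 'I_L) : (s < b)%N ->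
  run (mix (block_coords b) v phi) w s = run phi w s.
Proof.
apply: (@causal_sol_unique_upto _ _ (fun=> a0) (relay phi w)).
  exact: relay_causal.
move=> {}s sb; apply/funext => e; rewrite runE mix_notin // inE /=.
by apply: contraTneq sb => ->; rewrite ltnn.
Qed.

Lemma final_mix phi v w (b : 'I_L) i :
  final (mix (block_coords b) v phi) w i b = final phi w i b.
Proof. by apply: eq_state => s l sb; rewrite run_mix. Qed.

Variables (p : edge N -> A -> R) (bd : edge N -> R).
Hypothesis p_pmf : forall e, is_pmf (p e).
Hypothesis p_le : forall e a, p e a <= bd e.

Definition link_law (c : link_coord) : A -> R := p c.1.1.

Lemma link_law_pmf c : is_pmf (link_law c). Proof. exact: p_pmf. Qed.

Notation mu := (prod_pmf link_law).

(** If the separated set does not grow, every edge leaving it carried the same symbol in both runs,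
    although its tail was in two different states: these are collisions of freshly drawn symbols. *)
Lemma separated_stuck phi w w' (b : 'I_L) :
  \sum_v mu v * (separated (mix (block_coords b) v phi) w w' b.+1 ==
                 separated phi w w' b)%:R <=
  \prod_(e in finset.setX (separated phi w w' b) (~: separated phi w w' b)%SET)
     bd e.
Proof.
set T := separated phi w w' b.
pose c (x : W) (e : edge N) : link_coord := (e, b, final phi x e.1 b).
apply: le_trans (@prod_pmf_collision R _ _ link_law link_law_pmf _
    (finset.setX T (~: T)%SET) (c w) (c w') bd _ _ _).
- apply: ler_sum => v _; rewrite ler_wpM2l ?(prod_pmf_ge0 link_law_pmf) //.
  rewrite ler_nat; case: eqP => // sepT; rewrite lt0b.
  apply/forallP => -[i j]; apply/implyP; rewrite !inE /= => /andP[iT jT].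
  have := @separated_edge (mix (block_coords b) v phi) w w' b i j.
  rewrite sepT inE => /(_ jT); rewrite !runE /=.
  by rewrite -!/(final _ _ _ _) !final_mix !mix_in ?inE //= => ->.
- by move=> e e' [].
- move=> e e'; rewrite !inE => /andP[eT _] _.
  apply: contraNN eT => /eqP ce; apply/eqP; move: (congr1 snd ce) => /= ->.
  by move: (congr1 (fun x => x.1.1) ce) => /= ->.
- by move=> e a _; apply: p_le.
Qed.

Variables (w w' : W) (d : 'I_N) (theta : R).
Hypothesis theta_gt0 : 0 < theta.
Hypothesis theta_le1 : theta <= 1.
Hypothesis cut_le : forall T : {set 'I_N},
  [set i | own i w != own i w']%SET \subset T -> d \notin T ->
  \prod_(e in finset.setX T (~: T)%SET) bd e <= theta.

(* Each block either enlarges the separated set, gaining a factor [theta] in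
   the potential, or leaves it unchanged, which has probability at most
   [theta]. *)
Definition potential phi b : R :=
  let T := separated phi w w' b in
  if d \in T then 0 else theta ^+ #|T|.

(** The bounds for growth and for no growth are added, whence the factor 2. Once [d] separates the
    tuples the potential stays 0. *)
Lemma potential_step (b : 'I_L) :
  \sum_phi mu phi * potential phi b.+1 <=
  2 * theta * \sum_phi mu phi * potential phi b.
Proof.
rewrite (resample link_law_pmf (block_coords b)) mulr_sumr.
apply: ler_sum => phi _; rewrite [leRHS]mulrCA.
rewrite ler_wpM2l ?(prod_pmf_ge0 link_law_pmf) //.
rewrite /(potential phi); set T := separated phi w w' b.
have subT v : T \subset separated (mix (block_coords b) v phi) w w' b.+1.
  rewrite (_ : T = separated (mix (block_coords b) v phi) w w' b).
    exact: separated_sub.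
  by apply/setP => i; rewrite !inE !final_mix.
case: ifPn => dT.
  rewrite mulr0 big1 // => v _; rewrite /potential.
  by rewrite (fintype.subsetP (subT v) d dT) mulr0.
apply: (@le_trans _ _ (\sum_v mu v *
  (theta ^+ #|T| * ((separated (mix (block_coords b) v phi) w w' b.+1 == T)%:R
     + theta)))).
  apply: ler_sum => v _; rewrite ler_wpM2l ?(prod_pmf_ge0 link_law_pmf) //.
  rewrite /potential; case: ifP => _.
    by rewrite mulr_ge0 ?exprn_ge0 ?addr_ge0 // ltW.
  case: eqP => [->|/eqP neT].
    by rewrite ler_peMr ?exprn_ge0 1?ltW // ltrDl.
  rewrite add0r -exprSr ler_wiXn2l // 1?ltW //.
  by apply: proper_card; rewrite finset.properEneq eq_sym neT subT.
under eq_bigr => v _ do rewrite mulrCA mulrDr.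
rewrite -mulr_sumr big_split /= -mulr_suml.
rewrite (proj2 (prod_pmf_is_pmf link_law_pmf)) mul1r mulrC.
rewrite ler_wpM2r //; first by rewrite exprn_ge0 // ltW.
rewrite mulr_natl mulr2n lerD2r.
apply: le_trans (separated_stuck _ _ _ _) _; apply: cut_le => //.
by rewrite -(separated0 phi); apply: separated_sub.
Qed.

(** The separated set has at most [N] elements, so while [d] is outside it the potential is at least
    [theta ^+ N]. *)
Lemma not_separated_le :
  (\sum_phi mu phi * (d \notin separated phi w w' L)%:R) * theta ^+ N <=
  (2 * theta) ^+ L.
Proof.
apply: (@le_trans _ _ (\sum_phi mu phi * potential phi L)).
  rewrite mulr_suml; apply: ler_sum => phi _.
  rewrite -mulrA ler_wpM2l ?(prod_pmf_ge0 link_law_pmf) // /potential.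
  case: ifP => _; first by rewrite mul0r.
  rewrite mul1r ler_wiXn2l // 1?ltW //.
  by rewrite -[leqRHS](card_ord N) max_card.
have : (L <= L)%N by [].
elim: {1 3 4}L => [_|b IH bL].
  rewrite expr0 -[leRHS](proj2 (prod_pmf_is_pmf link_law_pmf)).
  apply: ler_sum => phi _; rewrite ler_piMr ?(prod_pmf_ge0 link_law_pmf) //.
  by rewrite /potential; case: ifP => // _; rewrite exprn_ile1 // ltW.
apply: le_trans (potential_step (Ordinal bL)) _.
by rewrite exprS ler_wpM2l //= ?IH //; [rewrite mulr_ge0 // ltW|rewrite ltnW].
Qed.

End RandomNetworkCode.

Section UnionBound.
Variables (R : realType) (N L : nat) (W S0 A : finType) (a0 : A).
Variable own : 'I_N -> W -> S0.
Variables (p : edge N -> A -> R) (bd : edge N -> R) (D : {set 'I_N}).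
Hypothesis p_pmf : forall e, is_pmf (p e).
Hypothesis p_le : forall e a, p e a <= bd e.
Hypothesis own_inj : forall w w', (forall i, own i w = own i w') -> w = w'.

Definition difference (w w' : W) : {set 'I_N} :=
  [set i | own i w != own i w']%SET.

Definition confusable (phi : link_code N L S0 A) (w : W) : bool :=
  [exists (d | d \in D), [exists (w' | w' != w),
     d \notin separated a0 own phi w w' L]].

Variables (count theta : {set 'I_N} -> R) (eta : R).
Hypothesis count_le : forall w S, S != finset.set0 ->
  (#|[set w' | difference w w' == S]%SET|%:R : R) <= count S.
Hypothesis theta_gt0 : forall w w', w != w' -> 0 < theta (difference w w').
Hypothesis theta_le1 : forall w w', w != w' -> theta (difference w w') <= 1.
Hypothesis cut_le : forall w w' d (T : {set 'I_N}), w != w' ->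
  difference w w' \subset T -> d \in D -> d \notin T ->
  \prod_(e in finset.setX T (~: T)%SET) bd e <= theta (difference w w').
Hypothesis eta_ge0 : 0 <= eta.
Hypothesis eta_ge : forall w w', w != w' -> let S := difference w w' in
  count S * ((2 * theta S) ^+ L / theta S ^+ N) <= eta.

Lemma difference_neq0 w w' : (difference w w' != finset.set0) = (w != w').
Proof.
apply/set0Pn/idP => [[i]|ww']; first by rewrite inE; apply: contraNneq => ->.
apply: contrapT => no; move/eqP: ww'; apply; apply: own_inj => i.
by apply/eqP/negPn/negP => ne; apply: no; exists i; rewrite inE.
Qed.

(** A union bound over destinations, difference sets and competing tuples; [N * 2 ^ N] bounds the
    number of pairs of the first two. Averaging then fixes one code. *)
Lemma exists_link_code : exists phi : link_code N L S0 A,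
  (forall c, 0 < p c.1.1 (phi c)) /\
  \sum_w (confusable phi w)%:R <= (#|W|%:R * (N * 2 ^ N)%N%:R * eta : R).
Proof.
pose mu := prod_pmf (@link_law R N L S0 A p).
have pp := @link_law_pmf R N L S0 A p p_pmf.
have mu_pmf : is_pmf mu := prod_pmf_is_pmf pp.
have pair_le w w' d : w != w' -> d \in D ->
    \sum_phi mu phi * (d \notin separated a0 own phi w w' L)%:R <=
    (2 * theta (difference w w')) ^+ L / theta (difference w w') ^+ N.
  move=> ww' dD; rewrite ler_pdivlMr ?exprn_gt0 ?theta_gt0 //.
  apply: (@not_separated_le R N L W S0 A a0 own p bd p_pmf p_le w w' d).
  - exact: theta_gt0.
  - exact: theta_le1.
  - by move=> T; move/cut_le; apply.
have word_le w : \sum_phi mu phi * (confusable phi w)%:R <=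
    (N * 2 ^ N)%N%:R * eta.
  apply: (@le_trans _ _ (\sum_(d in D) \sum_(w' | w' != w)
      \sum_phi mu phi * (d \notin separated a0 own phi w w' L)%:R)).
    under [leRHS]eq_bigr => d _ do rewrite exchange_big /=.
    rewrite [leRHS]exchange_big /=; apply: ler_sum => phi _.
    under [leRHS]eq_bigr => d _ do rewrite -mulr_sumr.
    rewrite -mulr_sumr ler_wpM2l ?(proj1 mu_pmf) //.
    rewrite /confusable; case: existsP => [[d /andP[dD /existsP[w' /andP[ww' sep]]]]|_].
      rewrite (bigD1 d) //= (bigD1 w') //= sep -addrA lerDl addr_ge0 //.
        by rewrite sumr_ge0.
      by rewrite sumr_ge0 // => *; rewrite sumr_ge0.
    by rewrite sumr_ge0 // => *; rewrite sumr_ge0.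
  apply: (@le_trans _ _ (\sum_(d in D) \sum_(S : {set 'I_N}) eta)); last first.
    have -> : \sum_(d in D) \sum_(S : {set 'I_N}) eta =
        (#|D| * 2 ^ N)%N%:R * eta.
      rewrite !sumr_const (_ : #|_| = 2 ^ N)%N.
        by rewrite -mulrnA mulr_natl mulnC.
      transitivity #|powerset [set: 'I_N]|; last first.
        by rewrite card_powerset cardsT card_ord.
      by apply: eq_card => S; rewrite !inE finset.subsetT.
    by rewrite ler_wpM2r // ler_nat leq_mul2r -[leqRHS]card_ord max_card orbT.
  apply: ler_sum => d dD.
  rewrite (partition_big (difference w) (fun S => S != finset.set0)) /=; last first.
    by move=> w'; rewrite difference_neq0 eq_sym.
  rewrite [leLHS]big_mkcond /=; apply: ler_sum => S _; case: ifP => // S0'.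
  have [/existsP[w0 /andP[ww0 /eqP wS]]|no] :=
      boolP [exists w', (w' != w) && (difference w w' == S)]; last first.
    rewrite big_pred0 // => w'; apply/negP => h; apply/negP: no.
    by rewrite negbK; apply/existsP; exists w'.
  rewrite eq_sym in ww0.
  apply: le_trans (eta_ge ww0); rewrite /= wS.
  apply: (@le_trans _ _ (\sum_(w' | (w' != w) && (difference w w' == S))
      ((2 * theta S) ^+ L / theta S ^+ N))).
    apply: ler_sum => w' /andP[ww' /eqP dS]; rewrite -dS.
    by apply: pair_le => //; rewrite eq_sym.
  have t0 : 0 <= (2 * theta S) ^+ L / theta S ^+ N.
    have := theta_gt0 ww0; rewrite wS => t0.
    by rewrite divr_ge0 ?exprn_ge0 ?mulr_ge0 // ltW.
  rewrite sumr_const -[leLHS]mulr_natl ler_wpM2r //.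
  apply: le_trans (count_le w S0'); rewrite ler_nat.
  by apply: subset_leq_card; apply/fintype.subsetP => w'; rewrite !inE => /andP[].
have : \sum_phi mu phi * \sum_w (confusable phi w)%:R <=
    #|W|%:R * (N * 2 ^ N)%N%:R * eta.
  under eq_bigr => phi _ do rewrite mulr_sumr.
  rewrite exchange_big /= -mulrA mulr_natl -sumr_const.
  by apply: ler_sum => w _; apply: word_le.
move/(is_pmf_support mu_pmf) => [phi phi_gt0 le_phi]; exists phi; split => // c.
rewrite lt0r (proj1 (p_pmf _)) andbT; apply: contraTneq phi_gt0 => c0.
by rewrite /mu /prod_pmf (bigD1 c) //= /link_law c0 mul0r ltxx.
Qed.

End UnionBound.

(** * Block codes on noisy networks *)

Section BlockCode.
Variables (R : realType) (N : nat) (net : network R N) (V : {set 'I_N}).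
Variables (n L m : nat) (M : 'I_N -> nat) (A : finType) (a0 : A).
Hypothesis M_gt0 : forall i, (0 < M i)%N.
Hypothesis M_notin : forall i, i \notin V -> M i = 1%N.
Hypothesis Lm_le : (L * m <= n)%N.

Definition source : finType := {i : 'I_N & 'I_(M i)}.
Definition own_message (i : 'I_N) (w : messages M) : source :=
  Tagged (fun i => 'I_(M i)) (w i).

Lemma own_message_inj w w' :
  (forall i, own_message i w = own_message i w') -> w = w'.
Proof.
move=> ww'; apply/ffunP => i; have /eqP := ww' i.
by rewrite /own_message eq_Tagged => /eqP.
Qed.

Variable lenc : forall e, A -> 'I_m -> inp net e.
Variable ldec : forall e, {ffun 'I_m -> out net e} -> A.
Variable phi : link_code N L source A.

(** [nth] copes with a tuple length that varies with time; its default is not reached for completed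
    blocks. *)
Definition read_block e (y : seq (out net e)) (b : 'I_L) : A :=
  ldec [ffun s : 'I_m => nth (out0 net e) y (b * m + s)].

(** [insub] fails exactly at times from [L * m] on, where a fixed letter is sent. *)
Definition block_enc (i j : 'I_N) (k : 'I_n) (w : 'I_(M i))
    (y : forall l, (k.+1 - all_one l i j)%N.-tuple (out net (l, i))) :
    inp net (i, j) :=
  if (insub (k %/ m)%N : option 'I_L, insub (k %% m)%N : option 'I_m)
    is (Some b, Some s) then
    lenc (i, j) (phi ((i, j), b,
      (Tagged (fun i => 'I_(M i)) w,
       [ffun x : 'I_L * 'I_N =>
         if (x.1 < b)%N then read_block (y x.2) x.1 else a0]))) s
  else inp0 net (i, j).

(** Searches for a tuple whose noiseless run ends in the observed state; without link failures the
    true tuple is a candidate, and the only one unless it is confusable. *)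
Definition block_dec (i j : 'I_N) (w : 'I_(M j))
    (y : forall l, n.-tuple (out net (l, j))) : 'I_(M i) :=
  if [pick w' : messages M | final a0 own_message phi w' j L ==
        (Tagged (fun i => 'I_(M i)) w,
         [ffun x : 'I_L * 'I_N => read_block (y x.2) x.1])] is Some w'
  then w' i else Ordinal (M_gt0 i).

Definition block_code : net_code net V all_one n :=
  NetCode M_gt0 M_notin block_enc block_dec.

Lemma block_time_subproof (b : 'I_L) (s : 'I_m) : (b * m + s < n)%N.
Proof.
apply: leq_trans Lm_le; apply: leq_trans (leq_mul (ltn_ord b) (leqnn m)).
by rewrite mulSn addnC ltn_add2r.
Qed.

Definition block_time b s : 'I_n := Ordinal (block_time_subproof b s).

Section Outputs.
Variable w : messages M.

Definition received (y : forall e, 'I_n -> out net e) (b : 'I_L) (e : edge N) :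
    A := ldec [ffun s => y e (block_time b s)].

Definition sent y (b : 'I_L) (e : edge N) : A :=
  phi (e, b, state a0 (own_message e.1 w) (received y) e.1 b).

Lemma block_input y b s e :
  code_input (c := block_code) w y e (block_time b s) = lenc e (sent y b e) s.
Proof.
case: e => i j; rewrite /code_input /= /block_enc /=.
rewrite divnMDl ?(leq_ltn_trans _ (ltn_ord s)) // divn_small // addn0.
rewrite modnMDl modn_small // !valK /sent /=.
congr (lenc _ (phi (_, _, (_, _))) _); apply/ffunP => x; rewrite !ffunE.
case: ifP => // xb; congr (ldec _); apply/ffunP => t; rewrite !ffunE.
(* Earlier blocks are complete before block [b] begins, so the unit delay hides nothing that is
   read. *)
have lt_t : (x.1 * m + t < (b * m + s).+1 - true)%N.
  rewrite subn1 /=; apply: (@leq_trans (b * m)); last exact: leq_addr.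
  by apply: leq_trans (leq_mul xb (leqnn m)); rewrite mulSn addnC ltn_add2r.
transitivity (tnth (out_prefix (block_time b s) true (y (x.2, i)))
    (Ordinal lt_t)); first by rewrite (tnth_nth (out0 net _)).
rewrite tnth_mktuple.
by congr (y _ _); apply: val_inj.
Qed.

Lemma sent_ext y y' (b : 'I_L) :
  (forall e (k : 'I_n), (k < b * m)%N -> y e k = y' e k) ->
  forall e, sent y b e = sent y' b e.
Proof.
move=> yy' e; rewrite /sent (@eq_state _ _ _ _ _ _ _ (received y')) // => b' l b'b.
congr (ldec _); apply/ffunP => s; rewrite !ffunE; apply: yy' => /=.
by apply: leq_trans (leq_mul b'b (leqnn m)); rewrite mulSn addnC ltn_add2r.
Qed.

Lemma received_run y : (forall b e, received y b e = sent y b e) ->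
  forall b, received y b = run a0 own_message phi w b.
Proof.
move=> ok b.
apply: (@causal_sol_unique_upto _ _ (fun=> a0) (relay a0 own_message phi w) _ L) => //.
  exact: relay_causal.
by move=> {}b _; apply/funext => e; rewrite ok.
Qed.

Lemma block_dec_correct (D : {set 'I_N}) y :
  (forall b e, received y b e = sent y b e) ->
  ~~ confusable a0 own_message D phi w ->
  forall i j, j \in D ->
  block_dec i (w j) (fun l => [tuple y (l, j) s | s < n]) = w i.
Proof.
move=> ok conf i j jD; rewrite /block_dec.
set st := (_, [ffun x => _]).
have -> : st = final a0 own_message phi w j L.
  rewrite /st /final /state; congr pair; apply/ffunP => x; rewrite !ffunE ltn_ord.
  rewrite -(received_run ok); congr (ldec _); apply/ffunP => s; rewrite !ffunE.
  transitivity (tnth [tuple y (x.2, j) s | s < n] (block_time x.1 s)).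
    by rewrite (tnth_nth (out0 net _)).
  by rewrite tnth_mktuple.
case: pickP => [w' /eqP eqf|/(_ w)]; last by rewrite eqxx.
suff -> : w' = w by [].
apply/eqP; apply: contraNT conf => ww'.
apply/existsP; exists j; rewrite jD /=; apply/existsP; exists w'.
by rewrite ww' inE /= eqf eqxx.
Qed.
End Outputs.

Notation mu := (prod_pmf (@noise_coord_law R N net n)).
Notation Y w u := (@out_seq _ _ _ _ _ block_code w u).

Variable eps : R.
Hypothesis link_error : forall c : link_coord N L source A,
  \sum_(y : {ffun 'I_m -> out net c.1.1})
    (\prod_s chan net c.1.1 (lenc c.1.1 (phi c) s) (y s)) *
    (ldec y != phi c)%:R <= eps.

(** All noise from time [b * m] on is redrawn. The symbol to send depends on earlier noise only, so
    it stays fixed while its block meets fresh channel uses. *)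
Lemma block_error (w : messages M) (b : 'I_L) (e : edge N) :
  \sum_(u : noise net n) mu u *
     (received (Y w u) b e != sent w (Y w u) b e)%:R <= eps.
Proof.
have np := @noise_coord_law_pmf R N net n.
pose J : {set 'I_n * {e : edge N & inp net e}} := 
    [set a : 'I_n * {e : edge N & inp net e} | (b * m <= a.1)%N]%SET.
rewrite (resample np J) -[leRHS]mul1r.
rewrite -[X in _ <= X * _](proj2 (prod_pmf_is_pmf np)) mulr_suml.
apply: ler_sum => u _; rewrite ler_wpM2l ?(prod_pmf_ge0 np) //.
pose c : link_coord N L source A :=
  (e, b, state a0 (own_message e.1 w) (received (Y w u)) e.1 b).
have sent_u v : sent w (Y w (mix J v u)) b e = phi c.
  rewrite -[RHS]/(sent w (Y w u) b e); apply: sent_ext => e' k kb.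
  apply: (@out_seq_ext _ _ _ _ _ block_code w _ _ (b * m)%N) kb => s a sb.
  rewrite mix_notin // inE /= -ltnNge.
  exact: sb.
have Yblock v s : Y w (mix J v u) e (block_time b s) =
    of_letter e (v (noise_coord (block_time b s) (lenc e (phi c) s))).
  by rewrite out_seqE /in_seq block_input sent_u mix_in // inE /= leq_addr.
pose F (y : {ffun 'I_m -> out net e}) : R := (ldec y != phi c)%:R.
apply: le_trans (link_error c); rewrite /=.
rewrite (eq_bigr (fun v : noise net n => mu v * F [ffun s : 'I_m =>
   of_letter e (v (noise_coord (block_time b s) (lenc e (phi c) s)))])); last first.
  move=> v _; rewrite sent_u /F /received; congr (_ * (_ != _)%:R).
  by congr (ldec _); apply/ffunP => s; rewrite !ffunE Yblock.
rewrite (prod_pmf_marginal np (of_letter e) F); last first.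
  move=> s s' /(congr1 (fun a => nat_of_ord a.1)) /= /eqP.
  by rewrite eqn_add2l => /eqP/val_inj.
apply: ler_sum => y _; rewrite le_eqVlt; apply/orP; left; apply/eqP.
congr (_ * _); apply: eq_bigr => s _.
exact: noise_law_of_letter.
Qed.

Lemma block_code_error (D : {set 'I_N}) (pi : 'S_(N ^ 2)) :
  error_prob D (omega_realization block_code pi) <=
  #|messages M|%:R^-1 * \sum_w (confusable a0 own_message D phi w)%:R +
  (L * N ^ 2)%N%:R * eps.
Proof.
have np := @noise_coord_law_pmf R N net n.
have [mu0 mu1] := prod_pmf_is_pmf np.
have W_gt0 : 0 < #|messages M|%:R :> R.
  by rewrite ltr0n; apply: (messages_gt0 M_gt0).
rewrite error_prob_omega.
apply: (@le_trans _ _ (#|messages M|%:R^-1 * \sum_w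
   ((confusable a0 own_message D phi w)%:R + (L * N ^ 2)%N%:R * eps))); last first.
  rewrite big_split /= mulrDr lerD2l sumr_const -(mulr_natl (_ * eps)) !mulrA.
  by rewrite mulVf ?mul1r // gt_eqF.
apply: ler_wpM2l; first by rewrite invr_ge0 ltW.
apply: ler_sum => w _.
have -> : (L * N ^ 2)%N%:R * eps = \sum_(b < L) \sum_(e : edge N) eps.
  by rewrite !sumr_const card_prod !card_ord -mulrnA mulr_natl mulnC.
apply: (@le_trans _ _ (\sum_u mu u * ((confusable a0 own_message D phi w)%:R +
   \sum_(b < L) \sum_(e : edge N)
     (received (Y w u) b e != sent w (Y w u) b e)%:R))); last first.
  under eq_bigr => u _ do rewrite mulrDr.
  rewrite big_split /= -mulr_suml mu1 mul1r lerD2l.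
  under eq_bigr => u _ do rewrite mulr_sumr.
  rewrite exchange_big /=; apply: ler_sum => b _.
  under eq_bigr => u _ do rewrite mulr_sumr.
  by rewrite exchange_big /=; apply: ler_sum => e _; apply: block_error.
apply: ler_sum => u _; rewrite ler_wpM2l //.
have S0 : 0 <= \sum_(b < L) \sum_(e : edge N)
     (received (Y w u) b e != sent w (Y w u) b e)%:R :> R.
  by rewrite sumr_ge0 // => b _; rewrite sumr_ge0.
case: existsP => [[i /andP[iV /existsP[j /andP[jD err]]]]|_]; last first.
  by rewrite addr_ge0.
case: (boolP (confusable _ _ _ _ _)) => conf; first by rewrite lerDl.
rewrite add0r.
have [/existsP[b /existsP[e be]]|ok] := boolP [exists b, exists e,
    received (Y w u) b e != sent w (Y w u) b e].
  rewrite (bigD1 b) //= (bigD1 e) //= be -addrA lerDl addr_ge0 //.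
    by rewrite sumr_ge0.
  by rewrite sumr_ge0 // => b' _; rewrite sumr_ge0.
case/negP: err; apply/eqP.
apply: (@block_dec_correct w D (Y w u) _ conf i j jD) => b e.
apply/eqP; apply: contraNT ok => ne.
by apply/existsP; exists b; apply/existsP; exists e.
Qed.

End BlockCode.

(** * Choice of the rates and block lengths *)

Section NetworkBlockCode.
Variables (R : realType) (N : nat) (net : network R N) (V D : {set 'I_N}).
Variables (n L m : nat) (M : 'I_N -> nat) (q : edge N -> nat) (eps eta : R).
Variable theta : {set 'I_N} -> R.
Hypothesis M_gt0 : forall i, (0 < M i)%N.
Hypothesis M_notin : forall i, i \notin V -> M i = 1%N.
Hypothesis q_gt0 : forall e, (0 < q e)%N.
Hypothesis Lm_le : (L * m <= n)%N.
Hypothesis link_codes : forall e, exists (enc : nat -> {ffun 'I_m -> inp net e})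
    (dec : {ffun 'I_m -> out net e} -> nat), forall i, (i < q e)%N ->
  \sum_y block_chan (enc i) y * (dec y != i)%:R <= eps.
Hypothesis eta_ge0 : 0 <= eta.

(* Only the sources with at least two messages can differ between two message
   tuples. *)
Definition active (S : {set 'I_N}) : Prop :=
  S != finset.set0 /\ forall i, i \in S -> (1 < M i)%N.

Hypothesis theta_ok : forall S, active S ->
  [/\ 0 < theta S, theta S <= 1 &
   (\prod_(i in S) M i)%:R * ((2 * theta S) ^+ L / theta S ^+ N) <= eta].
Hypothesis cut_ok : forall (S T : {set 'I_N}) d, active S -> S \subset T -> d \in D ->
  d \notin T ->
  \prod_(e in finset.setX T (~: T)%SET) (q e)%:R^-1 <= theta S.

Lemma difference_active (w w' : messages M) :
  w != w' -> active (difference (@own_message N M) w w').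
Proof.
move=> ww'; split; first by rewrite (difference_neq0 (@own_message_inj N M)).
move=> i; rewrite inE /own_message eq_Tagged => /eqP ne.
rewrite ltnNge; apply/negP => Mi; apply: ne; apply: val_inj => /=.
have := leq_trans (ltn_ord (w i)) Mi; have := leq_trans (ltn_ord (w' i)) Mi.
by rewrite !ltnS !leqn0 => /eqP -> /eqP ->.
Qed.

Lemma network_block_code : exists c : net_code net V all_one n,
  (forall i, msize c i = M i) /\
  forall pi : 'S_(N ^ 2), exists rv : realization pi c,
    error_prob D rv <= (N * 2 ^ N)%N%:R * eta + (L * N ^ 2)%N%:R * eps.
Proof.
(* ['I_Q.+1] is a common symbol alphabet; [p e] is uniform on its first [q e] symbols. *)
pose Q := \max_e q e.
have qQ e : (q e <= Q.+1)%N by rewrite leqW // leq_bigmax.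
pose p (e : edge N) (a : 'I_Q.+1) : R := (a < q e)%N%:R / (q e)%:R.
have q0 e : 0 < (q e)%:R :> R by rewrite ltr0n.
have p_pmf e : is_pmf (p e).
  split=> [a|]; first by rewrite divr_ge0.
  rewrite -mulr_suml -natr_sum (_ : (\sum_i _)%N = q e) ?divff ?gt_eqF //.
  rewrite -[RHS]card_ord -sum1_card (big_ord_widen _ (fun=> 1%N) (qQ e)).
  by rewrite [RHS]big_mkcond /=; apply: eq_bigr => a _; case: (_ < _)%N.
have p_le e a : p e a <= (q e)%:R^-1.
  by rewrite /p -[leRHS]mul1r ler_pM2r ?invr_gt0 // lern1 leq_b1.
have eta_ok (w w' : messages M) : w != w' ->
    let S := difference (@own_message N M) w w' in
    (\prod_(i in S) M i)%N%:R * ((2 * theta S) ^+ L / theta S ^+ N) <= eta.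
  by move=> ww'; have [] := theta_ok (difference_active ww').
have count_ok (w : messages M) S : S != finset.set0 ->
    #|[set w' | difference (@own_message N M) w w' == S]%SET|%:R <=
    (\prod_(i in S) M i)%N%:R :> R.
  move=> _; rewrite ler_nat -(card_agree_off S w); apply: subset_leq_card.
  apply/fintype.subsetP => w'; rewrite !inE => /eqP dS; apply/forallP => i.
  apply/implyP; rewrite -dS inE negbK /own_message eq_Tagged /= => /eqP <-.
  by rewrite eqxx.
have [phi [phi_q phi_err]] := exists_link_code (L := L) ord0 p_pmf p_le
  (@own_message_inj N M) count_ok
  (fun w w' ww' => let: And3 h _ _ := theta_ok (difference_active ww') in h)
  (fun w w' ww' => let: And3 _ h _ := theta_ok (difference_active ww') in h)
  (fun w w' d T ww' => @cut_ok _ T d (difference_active ww')) eta_ge0 eta_ok.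
pose enc e := sval (cid (link_codes e)).
pose dec e := sval (cid (svalP (cid (link_codes e)))).
have codeP e i : (i < q e)%N ->
    \sum_y block_chan (enc e i) y * (dec e y != i)%:R <= eps.
  exact: (svalP (cid (svalP (cid (link_codes e))))).
pose lenc e (a : 'I_Q.+1) (s : 'I_m) : inp net e := enc e a s.
pose ldec e (y : {ffun 'I_m -> out net e}) : 'I_Q.+1 := inord (dec e y).
have link_error (c : link_coord N L (source M) 'I_Q.+1) :
    \sum_(y : {ffun 'I_m -> out net c.1.1})
    (\prod_s chan net c.1.1 (lenc c.1.1 (phi c) s) (y s)) *
    (ldec _ y != phi c)%:R <= eps.
  (* Every symbol of [phi] has positive probability under [p], hence is the index of a codeword. *)
  have lt_q : (phi c < q c.1.1)%N.
    by have := phi_q c; rewrite /p; case: (_ < _)%N; rewrite ?mul0r ?ltxx.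
  apply: le_trans (codeP _ _ lt_q); apply: ler_sum => y _.
  apply: ler_wpM2l.
    by apply: prodr_ge0 => s _; case: (chan_pmf (lenc c.1.1 (phi c) s)).
  rewrite ler_nat /ldec; case: (dec _ y =P phi c) => [->|_]; last exact: leq_b1.
  by rewrite inord_val eqxx.
exists (@block_code R N net V n L m M 'I_Q.+1 ord0 M_gt0 M_notin lenc ldec phi); split=> // pi.
exists (omega_realization _ pi).
apply: le_trans (@block_code_error R N net V n L m M 'I_Q.+1 ord0 M_gt0 M_notin
  Lm_le lenc ldec phi eps link_error D pi) _.
rewrite lerD2r; have W0 : 0 < #|messages M|%:R :> R by rewrite ltr0n messages_gt0.
by rewrite ler_pdivrMl // mulrA.
Qed.
End NetworkBlockCode.

Section RateRounding.
Variable R : realType.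

Definition exp_size (x : R) : nat := maxn 1 (Num.truncn (expR x)).

Lemma exp_size_gt0 x : (0 < exp_size x)%N.
Proof. by rewrite leq_max. Qed.

Lemma expR_le_exp_size x : expR x <= 2 * (exp_size x)%:R.
Proof.
apply: (@le_trans _ _ ((Num.truncn (expR x)).+1%:R)); first exact/ltW/truncnS_gt.
by rewrite -natrM ler_nat /exp_size; move: (Num.truncn _) => k; lia.
Qed.

Lemma ln_exp_size x : x - ln 2 <= ln (exp_size x)%:R.
Proof.
have s0 : 0 < (exp_size x)%:R :> R by rewrite ltr0n exp_size_gt0.
rewrite lerBlDl -lnM ?posrE // -[leLHS]expRK ler_ln ?posrE ?expR_gt0 ?mulr_gt0 //.
exact: expR_le_exp_size.
Qed.

Lemma exp_size_inv_le x : (exp_size x)%:R^-1 <= expR (ln 2 - x).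
Proof.
have s0 : 0 < (exp_size x)%:R :> R by rewrite ltr0n exp_size_gt0.
rewrite expRD expRN lnK ?posrE // -[leLHS]mul1r ler_pdivrMr // mulrAC.
by rewrite ler_pdivlMr ?expR_gt0 // mul1r expR_le_exp_size.
Qed.

Lemma exp_size_le x : exp_size x = 1%N \/ (exp_size x)%:R <= expR x.
Proof.
rewrite /exp_size; have [lt1|le1] := ltnP (Num.truncn (expR x)) 1; last first.
  by right; rewrite truncn_le expR_ge0.
by left.
Qed.

Lemma exp_size_gt1 x : (1 < exp_size x)%N -> 0 < x /\ (exp_size x)%:R <= expR x.
Proof.
case: (exp_size_le x) => [-> //|le_x] gt1; split=> //.
by rewrite -expR_gt1; apply: lt_le_trans le_x; rewrite ltr1n.
Qed.

Lemma exists_nat_ge (x : R) : exists k : nat, forall j, (k <= j)%N -> x <= j%:R.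
Proof.
exists (Num.bound `|x|) => j kj; apply: le_trans (ler_norm x) _.
by apply: le_trans (ltW (archi_boundP (normr_ge0 x))) _; rewrite ler_nat.
Qed.

(* With [rho] the total rate of the differing sources: [n (rho - d)] counts the
   competing messages, the rest bounds the collision probability over [L]
   blocks of length [m]. *)
Lemma union_exponent (n m L N N2 rho rmax d dd l E : R) :
  0 <= m -> 0 <= N -> N <= L -> 0 <= N2 -> 0 <= l -> 0 < d ->
  n <= (m + 1) * L -> d <= rho -> rho <= rmax -> 0 <= dd -> dd <= d / 4 ->
  4 * (N * rmax) <= L * d ->
  E = m * (rho - dd) - N2 * l ->
  n * (rho - d) + (L * (l - E) + N * E) <=
  L * (rmax + l + N2 * l) - m * (L * d / 2).
Proof.
move=> m0 N0 NL N20 l0 d0 n_le d_rho rho_max dd0 dd_le NrL EE.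
have L0 : 0 <= L by apply: le_trans NL.
(* In the leading terms, [m * L * (rho - d) - m * (L - N) * (rho - d / 4)] is at most
   [m * N * rho - m * L * (3 * d / 4)], and [m * N * rho] is at most [m * L * d / 4]; this leaves
   [- (m * L * d / 2)]. *)
have h1 : n * (rho - d) <= (m + 1) * L * (rho - d).
  by rewrite ler_wpM2r // subr_ge0.
have h2 : (L - N) * (m * (rho - d / 4) - N2 * l) <= (L - N) * E.
  rewrite ler_wpM2l ?subr_ge0 // EE lerD2r ler_wpM2l //; lra.
have h3 : m * (4 * (N * rmax)) <= m * (L * d) by rewrite ler_wpM2l.
have h4 : m * (N * rho) <= m * (N * rmax) by rewrite !ler_wpM2l.
have h5 : 0 <= N * (N2 * l) by rewrite !mulr_ge0.
have h6 : L * rho <= L * rmax by rewrite ler_wpM2l.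
have h7 : 0 <= m * (N * d) by rewrite !mulr_ge0 // ltW.
have h8 : 0 <= L * d by rewrite mulr_ge0 // ltW.
have -> : L * (l - E) + N * E = L * l - (L - N) * E by ring.
move: h1 h2 h3 h4 h5 h6 h7 h8; rewrite EE; lra.
Qed.

End RateRounding.

Section Achievability.
Variables (R : realType) (N : nat) (net : network R N) (V D : {set 'I_N}).

Lemma achievable_approx (r : 'I_N -> R) (delta : R) :
  cutset_region net V D r -> 0 < delta ->
  exists n0 : nat, forall n, (n0 <= n)%N -> exists c : net_code net V all_one n,
    (forall i, r i - delta <= log2 (msize c i)%:R / n%:R) /\
    forall pi : 'S_(N ^ 2), exists rv : realization pi c, error_prob D rv <= delta.
Proof.
move=> [[r0 rV] r_cut] delta0.
pose l : R := ln 2; have l0 : 0 < l := ln2_gt0 R.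
pose rho i := l * r i; have rho0 i : 0 <= rho i by rewrite mulr_ge0 // ltW.
(* Rates are now in nats. Each source gives up half of [delta]; the other half covers rounding of
   the message number, by the choice of [n1]. *)
pose d := l * delta / 2; have d0 : 0 < d by rewrite divr_gt0 // mulr_gt0.
pose N2 : R := (N ^ 2)%N%:R; have N20 : 0 <= N2 by [].
(* The rate given up per link, such that a cut of at most [N ^ 2] links loses at most [d / 4]. *)
pose d2 := d / (4 * (N2 + 1)).
have N21 : 0 < 4 * (N2 + 1) by rewrite mulr_gt0 // ltr_wpDl.
have d20 : 0 < d2 by rewrite divr_gt0.
have dd0 : 0 <= N2 * d2 by rewrite mulr_ge0 // ltW.
have dd_le : N2 * d2 <= d / 4.
  have -> : d / 4 = (N2 + 1) * d2 by rewrite /d2; field; rewrite gt_eqF // ltr_wpDl.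
  by rewrite ler_pM2r // lerDl.
pose rmax := \sum_i rho i.
have rmax_ge (S : {set 'I_N}) : \sum_(i in S) rho i <= rmax.
  by rewrite /rmax [leRHS](bigID (mem S)) /= lerDl sumr_ge0.
(* [L] is so large that the [N] blocks possibly spent on growth cost at most [d / 4] in rate per
   block. *)
have [L1 L1P] := exists_nat_ge (4 * (N%:R * rmax) / d).
pose L := (N + L1).+1; have L0 : (0 < L)%N by [].
have NL : (N <= L)%N by rewrite leqW // leq_addr.
have NrL : 4 * (N%:R * rmax) <= L%:R * d.
  by rewrite -ler_pdivrMr //; apply: L1P; rewrite leqW // leq_addl.
pose eta := delta / 2 / ((N * 2 ^ N)%N%:R + 1).
pose eps := delta / 2 / ((L * N ^ 2)%N%:R + 1).
have eta0 : 0 < eta by rewrite !divr_gt0 // ltr_wpDl.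
have eps0 : 0 < eps by rewrite !divr_gt0 // ltr_wpDl.
have dl0 : 0 < d2 / l by rewrite divr_gt0.
have link e := channel_code net e dl0 eps0.
pose m1 := \max_e sval (cid (link e)).
(* [m2] makes the exponent [E] nonnegative, so that [theta <= 1]; [m3] brings the union bound below
   [eta]. *)
have [m2 m2P] := exists_nat_ge (N2 * l / (d * 3 / 4)).
have [m3 m3P] := exists_nat_ge ((L%:R * (rmax + l + N2 * l) - ln eta) /
  (L%:R * d / 2)).
have [n1 n1P] := exists_nat_ge (2 / delta).
exists (L * (m1 + m2 + m3) + n1.+1)%N => n n_ge.
pose m := (n %/ L)%N.
have m_ge : (m1 + m2 + m3 <= m)%N.
  by rewrite /m leq_divRL // mulnC; apply: leq_trans n_ge; apply: leq_addr.
have n0 : (0 < n)%N by apply: leq_trans n_ge; rewrite addnS.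
have n0R : 0 < n%:R :> R by rewrite ltr0n.
have n_le : n%:R <= (m%:R + 1) * L%:R :> R.
  rewrite natr1 -natrM ler_nat {1}(divn_eq n L) -/m mulSn addnC leq_add2r.
  by rewrite ltnW // ltn_mod.
pose M i := if i \in V then exp_size (n%:R * (rho i - d)) else 1%N.
pose q (e : edge N) := exp_size (m%:R * (l * capacity net e - d2)).
pose sum_rho (S : {set 'I_N}) := \sum_(i in S) rho i.
(* On each of at most [N ^ 2] links, [d2] is the rate given up and [l] the logarithm of the factor 2
   lost by rounding [q]. *)
pose E (S : {set 'I_N}) := m%:R * (sum_rho S - N2 * d2) - N2 * l.
pose theta S := expR (- E S).
have M_gt0 i : (0 < M i)%N by rewrite /M; case: ifP => // _; apply: exp_size_gt0.
have M_notin i : i \notin V -> M i = 1%N by rewrite /M => /negPf ->.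
have q_gt0 e : (0 < q e)%N := exp_size_gt0 _.
have Lm_le : (L * m <= n)%N by rewrite mulnC leq_divM.
have link_codes e : exists (enc : nat -> {ffun 'I_m -> inp net e})
    (dec : {ffun 'I_m -> out net e} -> nat), forall i, (i < q e)%N ->
    \sum_y block_chan (enc i) y * (dec y != i)%:R <= eps.
  have m_link : (sval (cid (link e)) <= m)%N.
    apply: (@leq_trans m1).
      exact: (leq_bigmax (F := fun e => sval (cid (link e)))).
    by apply: leq_trans m_ge; rewrite -addnA leq_addr.
  have [] := svalP (cid (link e)) m m_link (q e); last first.
    by move=> ec [dc P]; exists ec, dc.
  rewrite mulrBr -/l [l * (d2 / l)]mulrC divfK ?gt_eqF //.
  exact: exp_size_le.
have M_big i : (1 < M i)%N ->
    d < rho i /\ (M i)%:R <= expR (n%:R * (rho i - d)).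
  rewrite /M; case: ifP => // _ /exp_size_gt1[]; rewrite pmulr_rgt0 // subr_gt0.
  by [].
have activeP S : active M S -> [/\ d <= sum_rho S, 0 <= E S &
    (\prod_(i in S) M i)%N%:R <= expR (n%:R * (sum_rho S - d))].
  move=> [/set0Pn[i iS] S_big].
  have d_le : d <= sum_rho S.
    rewrite /sum_rho (bigD1 i) //=; have [/ltW lt_d _] := M_big _ (S_big _ iS).
    by apply: le_trans lt_d _; rewrite lerDl sumr_ge0.
  split=> //.
    rewrite /E subr_ge0; apply: (@le_trans _ _ (m%:R * (d * 3 / 4))).
      rewrite -ler_pdivrMr ?divr_gt0 ?mulr_gt0 //; apply: m2P.
      by apply: leq_trans m_ge; rewrite addnAC leq_addl.
    by rewrite ler_wpM2l //; move: dd_le d_le; lra.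
  rewrite natr_prod; apply: (@le_trans _ _
    (\prod_(i in S) expR (n%:R * (rho i - d)))).
    by apply: ler_prod => j jS; rewrite ler0n /=; have [] := M_big _ (S_big _ jS).
  rewrite -expR_sum ler_expR -mulr_sumr ler_wpM2l // sumrB lerB //.
  by rewrite (bigD1 i) //= lerDl sumr_ge0 // => j _; apply: ltW.
have theta_ok S : active M S -> [/\ 0 < theta S, theta S <= 1 &
   (\prod_(i in S) M i)%N%:R * ((2 * theta S) ^+ L / theta S ^+ N) <= eta].
  move=> /activeP[d_le E0 M_le]; split; first exact: expR_gt0.
    by rewrite /theta -expR0 ler_expR oppr_le0.
  have -> : (2 * theta S) ^+ L / theta S ^+ N =
      expR (L%:R * (l - E S) + N%:R * E S).
    rewrite expRD !expRM_natl expRD lnK ?posrE // -[RHS]mulrC mulrC.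
    by rewrite -exprVn /theta expRN invrK.
  apply: (@le_trans _ _ (expR (n%:R * (sum_rho S - d)) *
      expR (L%:R * (l - E S) + N%:R * E S))).
    by rewrite ler_wpM2r // expR_ge0.
  rewrite -expRD -[leRHS](lnK (x := eta)) ?posrE // ler_expR.
  apply: le_trans (union_exponent (ler0n _ m) (ler0n _ N) _ N20 (ltW l0) d0 n_le
    d_le (rmax_ge S) dd0 dd_le NrL erefl) _; first by rewrite ler_nat.
  rewrite lerBlDr -lerBlDl -ler_pdivrMr ?divr_gt0 ?mulr_gt0 ?ltr0n //.
  by apply: m3P; apply: leq_trans m_ge; apply: leq_addl.
have cut_ok (S T : {set 'I_N}) j : active M S -> S \subset T -> j \in D ->
    j \notin T ->
    \prod_(e in finset.setX T (~: T)%SET) (q e)%:R^-1 <= theta S.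
  move=> _ ST jD jT; set X := finset.setX _ _.
  apply: (@le_trans _ _ (\prod_(e in X)
      expR (l - m%:R * (l * capacity net e - d2)))).
    apply: ler_prod => e _; rewrite invr_ge0 ler0n /=; exact: exp_size_inv_le.
  rewrite -expR_sum /theta ler_expR.
  (* The cut condition is applied to [T], which may be larger than the difference set [S]; the rates
     of [T] dominate those of [S]. *)
  have cutT : sum_rho T <= l * \sum_(e in X) capacity net e.
    rewrite /sum_rho -mulr_sumr ler_pM2l //; apply: r_cut => /=.
    by apply/set0Pn; exists j; rewrite !inE jT.
  have rhoST : sum_rho S <= sum_rho T.
    rewrite /sum_rho [leRHS](bigID (mem S)) /=.
    rewrite [X in _ <= X + _](eq_bigl (fun i => i \in S)) => [|i]; first by rewrite lerDl sumr_ge0.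
    by rewrite andbC; case: (boolP (i \in S)) => //= /(fintype.subsetP ST).
  have -> : \sum_(e in X) (l - m%:R * (l * capacity net e - d2)) =
      #|X|%:R * (l + m%:R * d2) - m%:R * (l * \sum_(e in X) capacity net e).
    rewrite mulr_natl -sumr_const !mulr_sumr -sumrB; apply: eq_bigr => e _.
    by rewrite mulrBr mulrA; ring.
  have XN : #|X|%:R * (l + m%:R * d2) <= N2 * (l + m%:R * d2).
    have ld0 : 0 <= l + m%:R * d2.
      exact: addr_ge0 (ltW l0) (mulr_ge0 (ler0n _ _) (ltW d20)).
    apply: ler_wpM2r => //.
    have cardE : #|{: edge N}| = (N ^ 2)%N by rewrite card_prod card_ord mulnn.
    rewrite /N2 -cardE.
    by rewrite ler_nat max_card.
  have : m%:R * sum_rho S <= m%:R * (l * \sum_(e in X) capacity net e).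
    by rewrite ler_wpM2l // (le_trans rhoST).
  by move: XN; rewrite /E; lra.
have [c [cM c_err]] := network_block_code M_gt0 M_notin q_gt0 Lm_le link_codes
  (ltW eta0) theta_ok cut_ok.
exists c; split=> [i|pi].
  rewrite cM /log2 -/l /M; case: ifPn => iV; last first.
    by rewrite ln1 !mul0r (rV _ iV) sub0r oppr_le0 ltW.
  rewrite ler_pdivlMr // ler_pdivlMr //.
  apply: le_trans (ln_exp_size _).
  have : 2 / delta <= n%:R.
    by apply: n1P; apply: leq_trans n_ge; rewrite addnS leqW // leq_addl.
  rewrite ler_pdivrMr // => h2.
  have := ler_wpM2l (ltW l0) h2; rewrite -/l /rho /d; lra.
have [rv rv_err] := c_err pi; exists rv; apply: le_trans rv_err _.
rewrite [leRHS]splitr; apply: lerD.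
  rewrite /eta mulrCA ger_pMr ?divr_gt0 // ler_pdivrMr ?ltr_wpDl // mul1r.
  by rewrite lerDl.
rewrite /eps mulrCA ger_pMr ?divr_gt0 // ler_pdivrMr ?ltr_wpDl // mul1r.
by rewrite lerDl.
Qed.

End Achievability.

(** * Limits and the capacity region *)

Local Open Scope classical_set_scope.

Section Limits.
Variable R : realType.

Lemma limn_einf_geP (u : nat -> R) (x : R) :
  (x%:E <= limn_einf (fun n => (u n)%:E))%E <->
  forall delta, 0 < delta -> exists n0, forall n, (n0 <= n)%N -> x - delta <= u n.
Proof.
rewrite limn_einf_lim (cvg_lim _ (@cvg_einfs_sup _ _)) //; split=> [le_x delta d0|h].
  have : ((x - delta)%:E < ereal_sup (range (einfs (fun n => (u n)%:E))))%E.
    by apply: lt_le_trans le_x; rewrite lte_fin ltrBlDr ltrDl.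
  move=> /ereal_sup_gt[_ [n0 _ <-] lt_n0]; exists n0 => n n0n.
  rewrite -lee_fin; apply: le_trans (ltW lt_n0) _.
  by apply: ereal_inf_lbound; exists n.
apply/lee_subgt0Pr => delta d0; have [n0 n0P] := h _ d0.
apply: (@le_trans _ _ (einfs (fun n => (u n)%:E) n0)).
  by apply: le_ereal_inf_tmp => _ [n /= n0n <-]; rewrite -EFinB lee_fin n0P.
by apply: ereal_sup_ubound; exists n0.
Qed.

(** At index [n] the choice is as accurate as attainable among levels up to [n]; by monotonicity the
    same element serves all coarser levels. *)
Lemma diagonal_sequence (T : nat -> Type) (P : forall n : nat, nat -> T n -> Prop) :
  (forall n, T n) ->
  (forall n k k' c, (k <= k')%N -> P n k' c -> P n k c) ->
  (forall k, exists n0, forall n, (n0 <= n)%N -> exists c, P n k c) ->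
  exists c : forall n, T n,
    forall k, exists n0, forall n, (n0 <= n)%N -> P n k (c n).
Proof.
move=> c0 P_mono P_ev.
have best n j : exists c, forall k, (k <= j)%N -> (exists c', P n k c') -> P n k c.
  elim: j => [|j [c IH]].
    have [[c Pc]|no] := pselect (exists c', P n 0%N c').
      by exists c => k; rewrite leqn0 => /eqP ->.
    by exists (c0 n) => k; rewrite leqn0 => /eqP -> /no.
  have [[c' Pc]|no] := pselect (exists c', P n j.+1 c').
    by exists c' => k kj _; apply: P_mono kj Pc.
  by exists c => k; rewrite leq_eqVlt => /predU1P[-> /no //|]; apply: IH.
exists (fun n => sval (cid (best n n))) => k; have [n0 n0P] := P_ev k.
exists (maxn n0 k) => n; rewrite geq_max => /andP[n0n kn].
by apply: (svalP (cid (best n n))) => //; apply: n0P.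
Qed.

Lemma exists_inv_le (delta : R) : 0 < delta -> exists k : nat, k.+1%:R^-1 <= delta.
Proof.
move=> d0; have [k kP] := exists_nat_ge delta^-1; exists k.
rewrite invf_ple ?posrE // ; apply: le_trans (kP k (leqnn k)) _.
by rewrite ler_nat.
Qed.

Lemma le_of_perturbed (S C K : R) : 0 <= S -> 0 <= K ->
  (forall delta, 0 < delta -> delta < 1 ->
     (1 - delta) * (S - K * delta) <= C + delta) -> S <= C.
Proof.
move=> S0 K0 h; rewrite leNgt; apply/negP => CS.
have g0 : 0 < S - C by rewrite subr_gt0.
have D0 : 0 < 2 * (1 + S + K + (S - C)) by lra.
(* The total perturbation is at most [delta * (1 + S + K)], less than half the gap [S - C]; the
   summand [S - C] in the denominator keeps [delta] below 1. *)
pose delta := (S - C) / (2 * (1 + S + K + (S - C))).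
have d0 : 0 < delta by rewrite divr_gt0.
have dE : delta * (2 * (1 + S + K + (S - C))) = S - C by rewrite divfK ?gt_eqF.
have d1 : delta < 1 by rewrite ltr_pdivrMr // mul1r; lra.
have := h _ d0 d1.
have : 0 <= K * delta ^+ 2 by rewrite mulr_ge0 // sqr_ge0.
have : 0 < delta * (S - C) by rewrite mulr_gt0.
move: dE; lra.
Qed.

End Limits.

Section CapacityRegion.
Variables (R : realType) (N : nat) (net : network R N) (V D : {set 'I_N}).

Lemma error_prob_ge0 pi B n (c : net_code net V B n) (rv : realization pi c) :
  0 <= error_prob D rv.
Proof. by apply: sumr_ge0 => o _; case: (prob_pmf rv). Qed.

(** A filler for the blocklengths too short for the construction. *)
Lemma trivial_code_exists n : exists _ : net_code net V all_one n, True.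
Proof.
by exists (@NetCode R N net V all_one n (fun=> 1%N) (fun=> erefl) (fun _ _ => erefl)
  (fun i j k _ _ => inp0 net (i, j)) (fun _ _ _ _ => ord0)).
Qed.

Lemma achievability pi :
  cutset_region net V D `<=` achievable net V D pi all_one.
Proof.
move=> r r_cut; split; first by case: r_cut.
pose T n := {c : net_code net V all_one n.+1 & realization pi c}.
pose P n k (c : T n) := (forall i, r i - k.+1%:R^-1 <=
    log2 (msize (projT1 c) i)%:R / n.+1%:R) /\
  error_prob D (projT2 c) <= k.+1%:R^-1.
have [||k|c cP] := @diagonal_sequence T P.
- move=> n; have c := sval (cid (trivial_code_exists n.+1)).
  exact: existT _ c (omega_realization c pi).
- move=> n k k' c kk' [c_rate c_err].
  have le_inv : k'.+1%:R^-1 <= k.+1%:R^-1 :> R.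
    by rewrite lef_pV2 ?posrE // ler_nat.
  split=> [i|]; last exact: le_trans le_inv.
  by apply: le_trans (c_rate i); rewrite lerD2l lerN2.
- have k0 : 0 < k.+1%:R^-1 :> R by rewrite invr_gt0.
  have [n0 n0P] := achievable_approx r_cut k0; exists n0 => n n0n.
  have [c [c_rate c_err]] := n0P n.+1 (leqW n0n).
  by have [rv rv_err] := c_err pi; exists (existT _ c rv).
exists (fun n => projT1 (c n)), (fun n => projT2 (c n)); split=> [i|].
  apply/limn_einf_geP => delta d0; have [k k_le] := exists_inv_le d0.
  have [n0 n0P] := cP k; exists n0 => n /n0P[c_rate _].
  by apply: le_trans (c_rate i); rewrite lerD2l lerN2.
apply/cvgr0Pnorm_le => delta d0; have [k k_le] := exists_inv_le d0.
have [n0 n0P] := cP k; exists n0 => // n /= /n0P[_ c_err].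
by rewrite ger0_norm ?error_prob_ge0 // (le_trans c_err).
Qed.

Lemma converse pi B : feasible pi B ->
  achievable net V D pi B `<=` cutset_region net V D.
Proof.
move=> pi_B r [r_rate [c [rv [c_rate c_err]]]]; split=> // T /= /set0Pn[d].
rewrite !inE => /andP[dT dD]; have [r0 _] := r_rate.
set C := \sum_(e in finset.setX _ _) _.
have S0 : 0 <= \sum_(i in T) r i by rewrite sumr_ge0.
(* One [delta] bounds the error probability, the inverse blocklength and the rate deficit of each
   source; summing the deficits over [T] gives the constant [#|T|]. *)
apply: (le_of_perturbed S0 (ler0n _ #|T|)) => delta d0 d1.
pose y n i : R := log2 (msize (c n) i)%:R / n.+1%:R.
have y0 n i : 0 <= y n i.
  by rewrite !divr_ge0 ?ln_ge0 ?ler1n ?msize_gt0.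
have [n1 n1P] : exists n1, forall n, (n1 <= n)%N -> forall i, r i - delta <= y n i.
  have ex i : exists n0, forall n, (n0 <= n)%N -> r i - delta <= y n i.
    by have /limn_einf_geP := c_rate i; apply.
  exists (\max_i sval (cid (ex i))) => n n_ge i; apply: (svalP (cid (ex i))).
  by apply: leq_trans n_ge; apply: (leq_bigmax (F := fun i => sval (cid (ex i)))).
have /cvgr0Pnorm_le/(_ _ d0)[n2 _ n2P] := c_err.
have [n3 n3P] := exists_nat_ge delta^-1.
pose n := (n1 + n2 + n3)%N.
have n1n : (n1 <= n)%N by rewrite /n -addnA leq_addr.
have n2n : (n2 <= n)%N by rewrite /n addnAC leq_addl.
have n3n : (n3 <= n.+1)%N by rewrite leqW // leq_addl.
have err_le : error_prob D (rv n) <= delta.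
  by apply: le_trans (ler_norm _) _; apply: n2P.
have inv_n : n.+1%:R^-1 <= delta by rewrite invf_ple ?posrE // n3P.
have := converse_bound (rv n) pi_B dD dT.
have l0 := ln2_gt0 R.
have n0 : 0 < n.+1%:R :> R by [].
have -> : ln (\prod_(i in T) msize (c n) i)%N%:R =
    ln 2 * (n.+1%:R * \sum_(i in T) y n i).
  rewrite !mulr_sumr natr_prod.
  apply: (@proj2 (0 < \prod_(i in T) (msize (c n) i)%:R :> R)).
  elim/big_rec2: _ => [|i y1 y2 _ [y2_gt0 y2E]]; first by rewrite ln1 ltr01.
  have Mi : 0 < (msize (c n) i)%:R :> R by rewrite ltr0n msize_gt0.
  rewrite mulr_gt0 // lnM ?posrE // y2E; split=> //; congr (_ + _).
  by rewrite /y /log2; field; rewrite !gt_eqF.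
have -> : \sum_(e | cut_edge T e) capacity net e = C.
  by apply: eq_bigl => e; rewrite !inE.
rewrite mulrCA ler_pM2l // mulrCA -ler_pdivlMl // mulrDr mulKf ?gt_eqF // mulr1.
have Y0 : 0 <= \sum_(i in T) y n i by rewrite sumr_ge0.
have YS : \sum_(i in T) r i - #|T|%:R * delta <= \sum_(i in T) y n i.
  rewrite mulr_natl -sumr_const -sumrB; apply: ler_sum => i _; exact: n1P.
have h1 : (1 - delta) * (\sum_(i in T) r i - #|T|%:R * delta) <=
    (1 - delta) * \sum_(i in T) y n i.
  by rewrite ler_wpM2l // subr_ge0 ltW.
have h2 : (1 - delta) * \sum_(i in T) y n i <=
    (1 - error_prob D (rv n)) * \sum_(i in T) y n i.
  by rewrite ler_wpM2r // lerB.
move=> h3; apply: le_trans h1 _; apply: le_trans h2 _; apply: le_trans h3 _.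
by rewrite addrC lerD2l.
Qed.

End CapacityRegion.

Theorem theorem2 (R : realType) (N : nat) (net : network R N)
    (V D : {set 'I_N}) :
  capacity_region net V D = capacity_region_one net V D /\
  capacity_region_one net V D = cutset_region net V D.
Proof.
have one_sub : capacity_region_one net V D `<=` capacity_region net V D.
  by move=> r [pi _ r_pi]; exists pi => //; exists all_one.
have conv : capacity_region net V D `<=` cutset_region net V D.
  by move=> r [pi _ [B pi_B]]; apply: converse.
(* [achievability] holds for every operation sequence; the identity permutation is taken. *)
have ach : cutset_region net V D `<=` capacity_region_one net V D.
  by move=> r r_cut; exists 1%g => //; apply: achievability.
split; apply/seteqP; split=> //.
- exact: subset_trans conv ach.
- exact: subset_trans one_sub conv.
Qed.
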